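(* The theory $T$ of the measure algebra $\mathrm{MAlg}([0,1],\lambda)$ eliminates quantifiers, and for every $n\le\omega$ the map $$\mathrm{Aut}([0,1],\lambda)\backslash\!\backslash\,\mathrm{MAlg}([0,1],\lambda)^n\to S_n(T)$$ induced by $\bar a\mapsto\mathrm{tp}(\bar a)$ is a bijection.
   Context: Continuous logic. A metric language $\mathcal L$ consists of function symbols (with arity $\ge 0$ and a modulus of uniform continuity), relation symbols (with arity, modulus of uniform continuity and a bound $D_j>0$), and a bound $D>0$. An $\mathcal L$-structure is a complete metric space $(M,d^M)$ of diameter at most $D$ with interpretations $f^M:M^{k}\to M$ and $R_j^M:M^{k}\to[0,D_j]$ having the prescribed moduli, where $M^k$ carries the sum metric. Terms are built from variables and function symbols; atomic formulas are $R(t_1,\dots,t_k)$ with $t_i$ terms and $R$ a relation symbol or the distance symbol $d$; formulas are obtained from atomic formulas by applying continuous functions $\mathbb R^k\to\mathbb R$ (connectives) and the quantifiers $\sup_x$, $\inf_x$ (interpreted over $M$). A formula $\varphi(x_1,\dots,x_k)$ has an interpretation $\varphi^M:M^k\to\mathbb R$. A formula is quantifier-free if no $\sup$ or $\inf$ is used. A sentence is a formula without free variables. A theory is a set $T$ of sentences; $M$ is a model of $T$ if $\varphi^M=0$ for all $\varphi\in T$; $T$ is complete if it has a model and all its models give the same value to every sentence. $\mathrm{Th}(M)=\{\varphi\text{ sentence}:\varphi^M=0\}$ is complete. For $T$ complete, $\|\varphi\|_T=\sup|\varphi^M|$ (independent of the model $M$) is a seminorm on the $\mathbb R$-algebra of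 formulas; the Banach algebra $\mathfrak P^{\mathcal L,T}$ of definable predicates is its separation-completion, and for $n\le\omega$, $\mathfrak P^{\mathcal L,T}_n$ is the closure of the formulas with free variables among $x_1,\dots,x_n$ (all variables if $n=\omega$). A definable predicate in $\mathfrak P^{\mathcal L,T}_n$ has an interpretation $\varphi^M:M^n\to\mathbb R$ in each model (for $n=\omega$, $M^n=M^{\mathbb N}$). $S_n(T)$ is the space of nonzero continuous $\mathbb R$-algebra morphisms $\mathfrak P^{\mathcal L,T}_n\to\mathbb R$ of norm $\le1$ ($n$-types), and for $\bar a\in M^n$, $\mathrm{tp}(\bar a)(\varphi)=\varphi^M(\bar a)$. A complete theory $T$ eliminates quantifiers if the quantifier-free formulas are dense in the algebra of definable predicates $\mathfrak P^{\mathcal L,T}$. Measure algebras. For a probability space $(X,\mathcal B,\mu)$, $\mathrm{MAlg}(X,\mu)$ is $\mathcal B$ modulo null sets with metric $d_\mu(A,B)=\mu(A\triangle B)$; it is a structure in the language with two constants (interpreted as $\emptyset$ and $X$), three binary function symbols (interpreted as $\cup,\cap,\triangle$) and one unary relation symbol (interpreted as $\mu$), all with modulus of $1$-Lipschitz functions and all bounds $1$. $\mathrm{Aut}(X,\mu)$ is its automorphism group; $\lambda$ is Lebesgue measure. For a group $G$ acting by isometries on a metric space $(Y,d)$, $G\backslash\!\backslash Y$ is the set of closures of $G$-orbits, with metric $d_G([x],[y])=\inf_{g\in G}d(g\cdot x,y)$. Here $G$ acts diagonally on powers $M^n$; $M^n$ has the sum metric for $n<\omega$, and $M^\omega$ the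 metric $\sum_i2^{-i}\min(1,d(x_i,y_i))$. *)

(* Defs.v *)
From HB Require Import structures.
From mathcomp Require Import all_boot all_order all_algebra.
From mathcomp Require Import all_classical all_reals all_analysis.
From mathcomp Require Import ring lra.

Set Implicit Arguments.
Unset Strict Implicit.
Unset Printing Implicit Defensive.

Import Order.TTheory GRing.Theory Num.Theory.
Import numFieldNormedType.Exports.

Local Open Scope classical_set_scope.
Local Open Scope ring_scope.

(* [Complete] includes a base point, so the structures below are nonempty; the
   base point is not part of the language. *)
#[short(type="completeMetricType")]
HB.structure Definition CompleteMetric (K : numDomainType) :=
  {M of Metric K M & Complete M}.

(* Convention: f obeys the modulus w when d (f x) (f y) <= w (d x y); being
   1-Lipschitz is w = id. *)
Record modulus (R : realType) := Modulus {
  modulus_fun :> R -> R ;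
  modulus0 : modulus_fun 0 = 0 ;
  modulus_homo : forall r s, 0 <= r -> r <= s -> modulus_fun r <= modulus_fun s ;
  modulus_cvg0 : modulus_fun r @[r --> 0^'+] --> 0 }.

Record language (R : realType) := Language {
  fsym : Type ;
  farity : fsym -> nat ;
  fmodulus : fsym -> modulus R ;
  rsym : Type ;
  rarity : rsym -> nat ;
  rmodulus : rsym -> modulus R ;
  rbound : rsym -> R ;
  rbound_gt0 : forall r, 0 < rbound r ;
  dbound : R ;
  dbound_gt0 : 0 < dbound }.

Definition sum_dist (R : realType) (M : metricType R) k (x y : 'I_k -> M) : R :=
  \sum_(i < k) mdist (x i) (y i).

Record structure (R : realType) (L : language R) := Structure {
  carrier :> completeMetricType R ;
  finterp : forall f : fsym L, ('I_(farity f) -> carrier) -> carrier ;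
  rinterp : forall r : rsym L, ('I_(rarity r) -> carrier) -> R ;
  diam_le : forall x y : carrier, mdist x y <= dbound L ;
  finterp_modulus : forall f x y,
    mdist (@finterp f x) (@finterp f y) <= fmodulus f (sum_dist x y) ;
  rinterp_itv : forall r x, 0 <= @rinterp r x <= rbound r ;
  rinterp_modulus : forall r x y,
    `|@rinterp r x - @rinterp r y| <= rmodulus r (sum_dist x y) }.

Arguments finterp {R L} s f x.
Arguments rinterp {R L} s r x.

Section syntax.
Context {R : realType} {L : language R}.

Inductive term :=
| Var of nat
| App (f : fsym L) of 'I_(farity f) -> term.

Inductive formula :=
| Rel (r : rsym L) of 'I_(rarity r) -> term
| Dist of term & term
| Conn k (u : 'rV[R]_k -> R) of continuous u & 'I_k -> formula
| Sup of nat & formula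
| Inf of nat & formula.

Fixpoint term_var (t : term) (i : nat) : Prop :=
  match t with
  | Var j => j = i
  | App f a => exists k, term_var (a k) i
  end.

Fixpoint free_var (phi : formula) (i : nat) : Prop :=
  match phi with
  | Rel r a => exists k, term_var (a k) i
  | Dist t t' => term_var t i \/ term_var t' i
  | Conn k u _ a => exists j, free_var (a j) i
  | Sup j psi | Inf j psi => i <> j /\ free_var psi i
  end.

Fixpoint quantifier_free (phi : formula) : Prop :=
  match phi with
  | Rel _ _ | Dist _ _ => True
  | Conn k u _ a => forall j, quantifier_free (a j)
  | Sup _ _ | Inf _ _ => False
  end.

Definition sentence (phi : formula) : Prop := forall i, ~ free_var phi i.

Definition update (M : Type) (s : nat -> M) (i : nat) (x : M) : nat -> M :=
  fun j => if j == i then x else s j.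

Fixpoint eval_term (M : structure L) (s : nat -> M) (t : term) : M :=
  match t with
  | Var i => s i
  | App f a => finterp M f (fun k => eval_term s (a k))
  end.

Fixpoint eval (M : structure L) (s : nat -> M) (phi : formula) : R :=
  match phi with
  | Rel r a => rinterp M r (fun k => eval_term s (a k))
  | Dist t t' => mdist (eval_term s t) (eval_term s t')
  | Conn k u _ a => u (\row_j eval s (a j))
  | Sup i psi => sup (range (fun x => eval (update s i x) psi))
  | Inf i psi => inf (range (fun x => eval (update s i x) psi))
  end.

End syntax.

Arguments term {R} L.
Arguments formula {R} L.
Arguments eval {R L} M s phi.
Arguments eval_term {R L} M s t.

HB.instance Definition _ (R : realType) (L : language R) :=
  gen_eqMixin (formula L).
HB.instance Definition _ (R : realType) (L : language R) :=
  gen_choiceMixin (formula L).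

Section semantics.
Context {R : realType} {L : language R}.
Implicit Types (phi psi : formula L) (M N : structure L).

Lemma eval_term_eq M (s s' : nat -> M) (t : term L) :
  (forall i, term_var t i -> s i = s' i) -> eval_term M s t = eval_term M s' t.
Proof.
elim: t => [i|f a IH] /= h; first exact: h.
by congr finterp; apply/funext => k; apply: IH => i ti; apply: h; exists k.
Qed.

Lemma eval_eq M phi (s s' : nat -> M) :
  (forall i, free_var phi i -> s i = s' i) -> eval M s phi = eval M s' phi.
Proof.
elim: phi s s' => [r a|t t'|k u cu a IH|i psi IH|i psi IH] s s' /= h.
- congr rinterp; apply/funext => k; apply: eval_term_eq => i ti.
  by apply: h; exists k.
- by congr mdist; apply: eval_term_eq => i ti; apply: h; [left|right].
- congr u; apply/rowP => j; rewrite !mxE; apply: IH => i fi.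
  by apply: h; exists j.
- congr sup; apply: eq_imagel => x _; apply: IH => j fj.
  by rewrite /update; case: eqP => // /[dup] ij /eqP ?; apply: h.
- congr inf; apply: eq_imagel => x _; apply: IH => j fj.
  by rewrite /update; case: eqP => // /[dup] ij /eqP ?; apply: h.
Qed.

Lemma sup_abs_le (E : set R) (B : R) :
  E !=set0 -> (forall x, E x -> `|x| <= B) -> `|sup E| <= B.
Proof.
move=> [x Ex] EB; rewrite ler_norml; apply/andP; split.
  apply: (@le_trans _ _ x).
    by have := EB _ Ex; rewrite ler_norml => /andP[].
  apply: ub_le_sup => //; exists B => y /EB.
  by rewrite ler_norml => /andP[].
apply: ge_sup; first by exists x.
by move=> y /EB; rewrite ler_norml => /andP[].
Qed.

Lemma inf_abs_le (E : set R) (B : R) :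
  E !=set0 -> (forall x, E x -> `|x| <= B) -> `|inf E| <= B.
Proof.
move=> [x Ex] EB; rewrite /inf normrN; apply: sup_abs_le.
  by exists (- x), x.
by move=> _ [y Ey <-]; rewrite normrN; exact: EB.
Qed.

Lemma eval_bounded phi :
  exists B : R, forall M (s : nat -> M), `|eval M s phi| <= B.
Proof.
elim: phi => [r a|t t'|k u cu a /choice[B HB]|i psi [B HB]|i psi [B HB]].
- exists (rbound r) => M s /=.
  by have /andP[h0 h1] := rinterp_itv (s:=M) (r:=r) (fun k => eval_term M s (a k)); rewrite ger0_norm.
- by exists (dbound L) => M s /=; rewrite ger0_norm ?mdist_ge0 ?diam_le.
  pose C := [set v : 'rV[R]_k | forall j, `[- B j, B j]%classic (v ord0 j)].
  have cC : compact C.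
    by apply: (@rV_compact _ _ (fun j => `[- B j, B j]%classic)) => j; exact: segment_compact.
  have /compact_bounded [A [Ar hA]] : compact (u @` C).
    by apply: continuous_compact => //; exact: continuous_subspaceT.
  exists (A + 1) => M s /=; apply: hA; first by rewrite ltrDl.
  exists (\row_j eval M s (a j)) => // j /=.
  by rewrite mxE in_itv/= -ler_norml.
- exists B => M s /=; apply: sup_abs_le; first by exists (eval M (update s i point) psi), point.
  by move=> _ [x _ <-].
- exists B => M s /=; apply: inf_abs_le; first by exists (eval M (update s i point) psi), point.
  by move=> _ [x _ <-].
Qed.

End semantics.

Section connectives.
Context {R : realType} {L : language R}.
Implicit Types phi psi : formula L.

Let add_continuous :
  continuous (fun v : 'rV[R]_2 => v ord0 ord0 + v ord0 ord_max : R).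
Proof. by move=> v; exact: cvgD (@coord_continuous R 1 2 ord0 ord0 v)
  (@coord_continuous R 1 2 ord0 ord_max v). Qed.

Let mul_continuous :
  continuous (fun v : 'rV[R]_2 => v ord0 ord0 * v ord0 ord_max : R).
Proof. by move=> v; exact: cvgM (@coord_continuous R 1 2 ord0 ord0 v)
  (@coord_continuous R 1 2 ord0 ord_max v). Qed.

Let scale_continuous (c : R) :
  continuous (fun v : 'rV[R]_1 => c * v ord0 ord0 : R).
Proof. by move=> v; exact: cvgM (cvg_cst c) (@coord_continuous R 1 1 ord0 ord0 v). Qed.

Definition fcst (c : R) : formula L :=
  Conn (@cst_continuous 'rV[R]_0 R c) (fun i => Dist (Var i) (Var i)).

Definition fadd phi psi : formula L :=
  Conn add_continuous (fun i => if i == ord0 then phi else psi).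

Definition fmul phi psi : formula L :=
  Conn mul_continuous (fun i => if i == ord0 then phi else psi).

Definition fscale (c : R) phi : formula L :=
  Conn (scale_continuous (c := c)) (fun=> phi).

Definition fsub phi psi : formula L := fadd phi (fscale (-1) psi).

Lemma eval_cst (M : structure L) s c : eval M s (fcst c) = c.
Proof. by []. Qed.

Lemma eval_add (M : structure L) s phi psi :
  eval M s (fadd phi psi) = eval M s phi + eval M s psi.
Proof. by rewrite /= !mxE. Qed.

Lemma eval_mul (M : structure L) s phi psi :
  eval M s (fmul phi psi) = eval M s phi * eval M s psi.
Proof. by rewrite /= !mxE. Qed.

Lemma eval_scale (M : structure L) s c phi :
  eval M s (fscale c phi) = c * eval M s phi.
Proof. by rewrite /= !mxE. Qed.

Lemma eval_sub (M : structure L) s phi psi :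
  eval M s (fsub phi psi) = eval M s phi - eval M s psi.
Proof. by rewrite eval_add eval_scale mulN1r. Qed.

Lemma free_var_cst c i : ~ free_var (fcst c) i.
Proof. by move=> [[]]. Qed.

Lemma free_var_op phi psi i :
  (free_var (fadd phi psi) i <-> free_var phi i \/ free_var psi i) /\
  (free_var (fmul phi psi) i <-> free_var phi i \/ free_var psi i).
Proof.
by split; (split=> [[j] /=|[h|h]]; [case: ifP; [left|right]|exists ord0|exists ord_max]).
Qed.

Lemma free_var_scale c phi i : free_var (fscale c phi) i <-> free_var phi i.
Proof. by split=> [[j]|h] //; exists ord0. Qed.

End connectives.

Section theories.
Context {R : realType} {L : language R}.

Definition is_model (T : set (formula L)) (M : structure L) : Prop :=
  forall phi, T phi -> forall s, eval M s phi = 0.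

Record complete_theory := CompleteTheory {
  theory_set :> set (formula L) ;
  theory_sentence : forall phi, theory_set phi -> sentence phi ;
  theory_model : exists M, is_model theory_set M ;
  theory_complete : forall M N, is_model theory_set M -> is_model theory_set N ->
    forall phi, sentence phi -> forall s s', eval M s phi = eval N s' phi }.

Definition Th_set (M : structure L) : set (formula L) :=
  [set phi | sentence phi /\ forall s, eval M s phi = 0].

Lemma sentence_eval (M : structure L) phi s s' :
  sentence phi -> eval M s phi = eval M s' phi.
Proof. by move=> h; apply: eval_eq => i /h. Qed.

Lemma Th_value (M N : structure L) phi s s' : is_model (Th_set M) N ->
  sentence phi -> eval N s phi = eval M s' phi.
Proof.
move=> hN hphi.
have /hN/(_ s) : Th_set M (fsub phi (fcst (eval M s' phi))).
  split=> [i /(free_var_op _ _ _).1[/hphi//|/free_var_scale/free_var_cst//]|s''].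
  by rewrite eval_sub eval_cst (@sentence_eval _ _ s'' s')// subrr.
by rewrite eval_sub eval_cst => /eqP; rewrite subr_eq0 => /eqP.
Qed.

Let Th_sentence (M : structure L) phi : Th_set M phi -> sentence phi.
Proof. by case. Qed.

Let Th_model (M : structure L) : exists N, is_model (Th_set M) N.
Proof. by exists M => phi []. Qed.

Let Th_complete (M : structure L) N N' :
  is_model (Th_set M) N -> is_model (Th_set M) N' ->
  forall phi, sentence phi -> forall s s', eval N s phi = eval N' s' phi.
Proof.
move=> hN hN' phi hphi s s'.
by rewrite (Th_value s (fun=> point) hN hphi) (Th_value s' (fun=> point) hN' hphi).
Qed.

Definition Th (M : structure L) : complete_theory :=
  CompleteTheory (@Th_sentence M) (Th_model M) (@Th_complete M).

End theories.

Arguments complete_theory {R} L.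

Section seminorm.
Context {R : realType} {L : language R} (T : complete_theory L).
Implicit Types (phi psi : formula L) (M : structure L).

Let values phi : set R :=
  [set r | exists M, is_model T M /\ exists s, r = `|eval M s phi|].

(* Taken over all models of T at once; by completeness of T each single model
   gives the same supremum. *)
Definition seminorm phi : R := sup (values phi).

Let values_neq0 phi : values phi !=set0.
Proof.
by have [M hM] := theory_model T; exists `|eval M (fun=> point) phi|, M; split=> //; exists (fun=> point).
Qed.

Let values_ub phi : has_ubound (values phi).
Proof. by have [B hB] := eval_bounded phi; exists B => _ [M [_ [s ->]]]. Qed.

Lemma seminorm_ub M s phi : is_model T M -> `|eval M s phi| <= seminorm phi.
Proof. by move=> hM; apply: ub_le_sup => //; exists M; split=> //; exists s. Qed.

Lemma seminorm_le phi (c : R) :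
  (forall M, is_model T M -> forall s, `|eval M s phi| <= c) -> seminorm phi <= c.
Proof. by move=> h; apply: ge_sup => // _ [M [hM [s ->]]]; exact: h. Qed.

Lemma seminorm_ge0 phi : 0 <= seminorm phi.
Proof.
have [M hM] := theory_model T.
exact: le_trans (normr_ge0 _) (seminorm_ub (fun=> point) phi hM).
Qed.

Lemma seminorm_sub_dist phi psi :
  `|seminorm phi - seminorm psi| <= seminorm (fsub phi psi).
Proof.
have h a b : seminorm a <= seminorm b + seminorm (fsub a b).
  apply: seminorm_le => M hM s.
  have := seminorm_ub s (fsub a b) hM; rewrite eval_sub => h1.
  have h2 := seminorm_ub s b hM.
  rewrite -[eval M s a](subrK (eval M s b)) addrC.
  by apply: (le_trans (ler_normD _ _)); apply: lerD.
have hs : seminorm (fsub psi phi) <= seminorm (fsub phi psi).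
  apply: seminorm_le => M hM s.
  by have := seminorm_ub s (fsub phi psi) hM; rewrite !eval_sub distrC.
rewrite ler_norml lerBlDl lerBrDl h andbT.
by rewrite lerBlDr (le_trans (h psi phi)) ?lerD2l.
Qed.

End seminorm.

(* The Banach algebra of definable predicates: Cauchy sequences of formulas for
   the seminorm, modulo sequences at distance tending to 0. *)
Section definable_predicates.
Context {R : realType} {L : language R} (T : complete_theory L).
Implicit Types (phi psi : formula L) (M : structure L).

Definition cauchy_formulas : set (nat -> formula L) :=
  [set u | forall e : R, 0 < e -> exists N, forall m n, (N <= m)%N -> (N <= n)%N ->
     seminorm T (fsub (u m) (u n)) < e].

Implicit Types u v w : cauchy_formulas.

Definition null_equiv u v : bool :=
  `[< seminorm T (fsub (set_val u n) (set_val v n)) @[n --> \oo] --> (0 : R) >].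

Lemma cauchy_formulas_eval (u : nat -> formula L) M s :
  cauchy_formulas u -> is_model T M -> cvgn (fun n => eval M s (u n)).
Proof.
move=> uc hM; apply/cauchy_cvgP/cauchy_exP => e e0.
have [N hN] := uc _ e0; exists (eval M s (u N)); exists N => // n /= Nn.
rewrite /ball/= -eval_sub.
by apply: le_lt_trans (hN _ _ (leqnn N) Nn); exact: seminorm_ub.
Qed.

Lemma null_equiv_val u v : null_equiv u v <->
  (forall M, is_model T M -> forall s,
    limn (fun n => eval M s (set_val u n)) = limn (fun n => eval M s (set_val v n))).
Proof.
split=> [/asboolP uv M hM s|uv].
  have cu := @cauchy_formulas_eval _ M s (set_valP u) hM.
  have cv := @cauchy_formulas_eval _ M s (set_valP v) hM.
  have h : (eval M s (set_val u n) - eval M s (set_val v n)) @[n --> \oo] --> (0 : R).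
    apply/norm_cvg0P; apply: (squeeze_cvgr _ (cvg_cst _) uv); apply: nearW => n.
    by rewrite normr_ge0/= -eval_sub seminorm_ub.
  by apply/eqP; rewrite -subr_eq0; apply/eqP; apply: (cvg_unique _ (cvgB cu cv) h).
apply/asboolP/cvgrPdist_le => e e0.
have e20 : 0 < e / 2 by rewrite divr_gt0.
have [N hN] := set_valP u _ e20; have [K hK] := set_valP v _ e20.
exists (maxn N K) => // n /=; rewrite geq_max => /andP[Nn Kn].
rewrite sub0r normrN ger0_norm ?seminorm_ge0//; apply: seminorm_le => M hM s.
have cu := @cauchy_formulas_eval _ M s (set_valP u) hM.
have cv := @cauchy_formulas_eval _ M s (set_valP v) hM.
rewrite eval_sub.
have h0 : (eval M s (set_val u k) - eval M s (set_val v k)) @[k --> \oo] --> (0 : R).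
  have := cvgB cu cv; rewrite uv// subrr; exact.
have := cvg_norm (cvgB (cvg_cst (eval M s (set_val u n) - eval M s (set_val v n))) h0).
rewrite subr0 => /(_ _ _ _) hc.
apply: (cvgr_to_le hc); exists (maxn N K) => // k /=; rewrite geq_max => /andP[Nk Kk].
have hu := seminorm_ub s (fsub (set_val u n) (set_val u k)) hM.
have hv := seminorm_ub s (fsub (set_val v n) (set_val v k)) hM.
have /ltW hu' := hN _ _ Nn Nk; have /ltW hv' := hK _ _ Kn Kk.
rewrite [X in `|X|](_ : _ = (eval M s (set_val u n) - eval M s (set_val u k)) -
  (eval M s (set_val v n) - eval M s (set_val v k))); last by rewrite /= !fctE; ring.
rewrite (splitr e) (le_trans (ler_normB _ _))// lerD//.
  by apply: le_trans hu'; move: hu; rewrite eval_sub.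
by apply: le_trans hv'; move: hv; rewrite eval_sub.
Qed.

Let null_equiv_refl : reflexive null_equiv.
Proof. by move=> u; apply/null_equiv_val. Qed.

Let null_equiv_sym : symmetric null_equiv.
Proof.
by move=> u v; apply/idP/idP => /null_equiv_val h; apply/null_equiv_val => M hM s; rewrite h.
Qed.

Let null_equiv_trans : transitive null_equiv.
Proof.
move=> v u w /null_equiv_val uv /null_equiv_val vw.
by apply/null_equiv_val => M hM s; rewrite uv// vw.
Qed.

Canonical null_equiv_canonical :=
  EquivRel null_equiv null_equiv_refl null_equiv_sym null_equiv_trans.

Local Open Scope quotient_scope.

Definition definable_predicate : Type := {eq_quot null_equiv}.
HB.instance Definition _ := Choice.on definable_predicate.
HB.instance Definition _ := EqQuotient.on definable_predicate.

Local Notation P := definable_predicate.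
Implicit Types p q : P.

Definition rep p : nat -> formula L := set_val (repr p).

(* Meaningful when M is a model of T: the sequence then converges. *)
Definition interp M (s : nat -> M) p : R := limn (fun n => eval M s (rep p n)).

Lemma rep_cauchy p : cauchy_formulas (rep p).
Proof. exact: set_valP. Qed.

Definition class_of (u : nat -> formula L) (uc : cauchy_formulas u) : P :=
  \pi_definable_predicate (exist _ u (mem_set uc) : cauchy_formulas).

Lemma interp_class M (s : nat -> M) (u : nat -> formula L) (uc : cauchy_formulas u) : is_model T M ->
  interp s (class_of uc) = limn (fun n => eval M s (u n)).
Proof.
move=> hM; rewrite /interp /rep /class_of; case: piP => v /eqmodP.
by move=> /null_equiv_val/(_ M hM s) <-.
Qed.

Lemma interp_cvg M (s : nat -> M) p : is_model T M ->
  eval M s (rep p n) @[n --> \oo] --> interp s p.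
Proof. by apply: cauchy_formulas_eval; exact: rep_cauchy. Qed.

Lemma interp_inj p q :
  (forall M, is_model T M -> forall s : nat -> M, interp s p = interp s q) -> p = q.
Proof.
move=> h; rewrite -[p]reprK -[q]reprK; apply/eqmodP/null_equiv_val => M hM s.
exact: h.
Qed.

Lemma interp_unif p (e : R) : 0 < e ->
  exists N, forall n, (N <= n)%N -> forall M, is_model T M -> forall s : nat -> M,
    `|eval M s (rep p n) - interp s p| <= e.
Proof.
move=> e0; have [N hN] := rep_cauchy p e0; exists N => n Nn M hM s.
have hc : `|eval M s (rep p n) - eval M s (rep p k)| @[k --> \oo]
    --> `|eval M s (rep p n) - interp s p|.
  by apply: cvg_norm; apply: cvgB; [exact: cvg_cst|exact: interp_cvg].
apply: (cvgr_to_le hc); exists N => // k /= Nk; rewrite -eval_sub.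
by apply: le_trans (ltW (hN _ _ Nn Nk)); exact: seminorm_ub.
Qed.

Definition pnorm p : R := limn (fun n => seminorm T (rep p n)).

Lemma pnorm_cvg p : seminorm T (rep p n) @[n --> \oo] --> pnorm p.
Proof.
apply: (_ : cvgn _); apply/cauchy_cvgP/cauchy_exP => e e0.
have [N hN] := rep_cauchy p e0; exists (seminorm T (rep p N)); exists N => // n /= Nn.
rewrite /ball/=; apply: le_lt_trans (hN _ _ (leqnn N) Nn).
exact: seminorm_sub_dist.
Qed.

Lemma interp_le_pnorm M (s : nat -> M) p : is_model T M -> `|interp s p| <= pnorm p.
Proof.
move=> hM.
have h1 : `|eval M s (rep p n)| @[n --> \oo] --> `|interp s p|.
  by apply: cvg_norm; exact: interp_cvg.
have h2 := @pnorm_cvg p.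
rewrite -(cvg_lim _ h1)// -(cvg_lim _ h2)//; apply: ler_lim.
- exact: cvgP h1.
- exact: cvgP h2.
- by apply: nearW => n; exact: seminorm_ub.
Qed.

Lemma pnorm_le p (c : R) :
  (forall M, is_model T M -> forall s : nat -> M, `|interp s p| <= c) -> pnorm p <= c.
Proof.
move=> h; apply/ler_addgt0Pl => e e0; have [N hN] := interp_unif p e0.
apply: (cvgr_to_le (@pnorm_cvg p)); exists N => // n /= Nn.
apply: seminorm_le => M hM s.
rewrite -[eval _ _ _](subrK (interp s p)) (le_trans (ler_normD _ _))// lerD//.
  exact: hN.
exact: h.
Qed.

Lemma cst_cauchy phi : cauchy_formulas (fun=> phi).
Proof.
move=> e e0; exists 0 => m n _ _; apply: le_lt_trans e0.
by apply: seminorm_le => M hM s; rewrite eval_sub subrr normr0.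
Qed.

Definition of_formula phi : P := class_of (cst_cauchy phi).

Lemma interp_of_formula M (s : nat -> M) phi : is_model T M ->
  interp s (of_formula phi) = eval M s phi.
Proof. by move=> hM; rewrite interp_class// lim_cst. Qed.

Lemma pnorm_of_formula phi : pnorm (of_formula phi) = seminorm T phi.
Proof.
apply/eqP; rewrite eq_le; apply/andP; split.
  apply: pnorm_le => M hM s; rewrite interp_of_formula//; exact: seminorm_ub.
apply: seminorm_le => M hM s; rewrite -interp_of_formula//; exact: interp_le_pnorm.
Qed.

Lemma add_cauchy (u v : nat -> formula L) : cauchy_formulas u -> cauchy_formulas v ->
  cauchy_formulas (fun n => fadd (u n) (v n)).
Proof.
move=> uc vc e e0; have e20 : 0 < e / 2 by rewrite divr_gt0.
have [N hN] := uc _ e20; have [K hK] := vc _ e20.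
exists (maxn N K) => m n; rewrite !geq_max => /andP[Nm Km] /andP[Nn Kn].
rewrite (splitr e); apply: le_lt_trans (ltrD (hN _ _ Nm Nn) (hK _ _ Km Kn)).
apply: seminorm_le => M hM s; rewrite eval_sub !eval_add opprD addrACA.
by rewrite (le_trans (ler_normD _ _))// lerD// -eval_sub seminorm_ub.
Qed.

Lemma scale_cauchy c (u : nat -> formula L) : cauchy_formulas u ->
  cauchy_formulas (fun n => fscale c (u n)).
Proof.
move=> uc e e0; have c0 : 0 < `|c| + 1 by rewrite ltr_wpDl.
have [N hN] := uc _ (divr_gt0 e0 c0).
exists N => m n Nm Nn; have := hN _ _ Nm Nn; rewrite ltr_pdivlMr//.
apply: le_lt_trans; apply: seminorm_le => M hM s.
rewrite eval_sub !eval_scale -mulrBr normrM mulrC.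
by rewrite ler_pM// -?eval_sub ?seminorm_ub// lerDl.
Qed.

Lemma cauchy_bounded (u : nat -> formula L) : cauchy_formulas u ->
  exists2 B : R, 0 < B & exists N, forall n, (N <= n)%N -> seminorm T (u n) <= B.
Proof.
move=> uc; have [N hN] := uc 1 ltr01; exists (seminorm T (u N) + 1).
  by rewrite ltr_wpDl// seminorm_ge0.
exists N => n Nn; have := le_trans (seminorm_sub_dist T (u N) (u n)) (ltW (hN _ _ (leqnn N) Nn)).
by rewrite distrC ler_norml lerBlDl addrC => /andP[].
Qed.

Lemma mul_cauchy (u v : nat -> formula L) : cauchy_formulas u -> cauchy_formulas v ->
  cauchy_formulas (fun n => fmul (u n) (v n)).
Proof.
move=> uc vc e e0.
have [A A0 [N0 hA]] := cauchy_bounded uc; have [B B0 [K0 hB]] := cauchy_bounded vc.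
have eA : 0 < e / 2 / A by rewrite !divr_gt0.
have eB : 0 < e / 2 / B by rewrite !divr_gt0.
have [N hN] := uc _ eB; have [K hK] := vc _ eA.
exists (maxn (maxn N0 K0) (maxn N K)) => m n; rewrite !geq_max.
move=> /andP[/andP[N0m K0m] /andP[Nm Km]] /andP[/andP[N0n K0n] /andP[Nn Kn]].
have := hN _ _ Nm Nn; rewrite ltr_pdivlMr// => h1.
have := hK _ _ Km Kn; rewrite ltr_pdivlMr// => h2.
rewrite (splitr e); apply: le_lt_trans (ltrD h1 h2).
apply: seminorm_le => M hM s; rewrite eval_sub !eval_mul.
rewrite (_ : _ - _ = (eval M s (u m) - eval M s (u n)) * eval M s (v m)
   + (eval M s (v m) - eval M s (v n)) * eval M s (u n)); last by ring.
rewrite (le_trans (ler_normD _ _))// !normrM -!eval_sub.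
by rewrite lerD// ler_pM ?seminorm_ub//;
  [exact: le_trans (seminorm_ub s _ hM) (hB _ K0m)
  |exact: le_trans (seminorm_ub s _ hM) (hA _ N0n)].
Qed.

Definition padd p q : P := class_of (add_cauchy (rep_cauchy p) (rep_cauchy q)).
Definition pmul p q : P := class_of (mul_cauchy (rep_cauchy p) (rep_cauchy q)).
Definition pscale c p : P := class_of (scale_cauchy c (rep_cauchy p)).
Definition popp p : P := pscale (-1) p.

Let interp_add M (s : nat -> M) p q : is_model T M ->
  interp s (padd p q) = interp s p + interp s q.
Proof.
move=> hM; rewrite interp_class//; apply: cvg_lim => //.
under eq_fun do rewrite eval_add.
by apply: cvgD; exact: interp_cvg.
Qed.

Let interp_mul M (s : nat -> M) p q : is_model T M ->
  interp s (pmul p q) = interp s p * interp s q.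
Proof.
move=> hM; rewrite interp_class//; apply: cvg_lim => //.
under eq_fun do rewrite eval_mul.
by apply: cvgM; exact: interp_cvg.
Qed.

Let interp_scale M (s : nat -> M) c p : is_model T M ->
  interp s (pscale c p) = c * interp s p.
Proof.
move=> hM; rewrite interp_class//; apply: cvg_lim => //.
under eq_fun do rewrite eval_scale.
by apply: cvgM; [exact: cvg_cst|exact: interp_cvg].
Qed.

Let interp_opp M (s : nat -> M) p : is_model T M -> interp s (popp p) = - interp s p.
Proof. by move=> hM; rewrite interp_scale// mulN1r. Qed.

Let interp_cst M (s : nat -> M) c : is_model T M -> interp s (of_formula (fcst c)) = c.
Proof. by move=> hM; rewrite interp_of_formula. Qed.

Let interpE := (interp_add, interp_mul, interp_scale, interp_opp, interp_cst).

Ltac by_interp := (repeat (let x := fresh "x" in intro x));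
  apply: interp_inj => M hM s; rewrite !interpE//.

Fact paddA : associative padd. Proof. by_interp; ring. Qed.
Fact paddC : commutative padd. Proof. by_interp; ring. Qed.
Fact padd0 : left_id (of_formula (fcst 0)) padd. Proof. by_interp; ring. Qed.
Fact paddN : left_inverse (of_formula (fcst 0)) popp padd.
Proof. by_interp; ring. Qed.

HB.instance Definition _ := GRing.isZmodule.Build P paddA paddC padd0 paddN.

Fact pmulA : associative pmul. Proof. by_interp; ring. Qed.
Fact pmulC : commutative pmul. Proof. by_interp; ring. Qed.
Fact pmul1 : left_id (of_formula (fcst 1)) pmul. Proof. by_interp; ring. Qed.
Fact pmulDl : left_distributive pmul padd. Proof. by_interp; ring. Qed.
Fact pone_neq0 : of_formula (fcst 1) != of_formula (fcst 0).
Proof.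
have [M hM] := theory_model T; apply/eqP => /(congr1 (interp (fun=> point : M))).
by rewrite !interp_cst// => /eqP; rewrite oner_eq0.
Qed.

HB.instance Definition _ :=
  GRing.Zmodule_isComNzRing.Build P pmulA pmulC pmul1 pmulDl pone_neq0.

Fact pscaleA a b p : pscale a (pscale b p) = pscale (a * b) p.
Proof. by_interp; ring. Qed.
Fact pscale1 : left_id 1 pscale. Proof. by_interp; ring. Qed.
Fact pscaleDr : right_distributive pscale padd. Proof. by_interp; ring. Qed.
Fact pscaleDl p : {morph pscale^~ p : a b / a + b >-> padd a b}.
Proof. by_interp; ring. Qed.

HB.instance Definition _ :=
  GRing.Zmodule_isLmodule.Build R P pscaleA pscale1 pscaleDr pscaleDl.

Fact pscaleAl (c : R) (p q : P) : c *: (p * q) = (c *: p) * q.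
Proof. by_interp; ring. Qed.

HB.instance Definition _ := GRing.Lmodule_isLalgebra.Build R P pscaleAl.
HB.instance Definition _ := GRing.Lalgebra_isComAlgebra.Build R P.

Lemma interpD M (s : nat -> M) p q : is_model T M ->
  interp s (p + q) = interp s p + interp s q.
Proof. exact: interp_add. Qed.

Lemma interpM M (s : nat -> M) p q : is_model T M ->
  interp s (p * q) = interp s p * interp s q.
Proof. exact: interp_mul. Qed.

Lemma interpZ M (s : nat -> M) c p : is_model T M ->
  interp s (c *: p) = c * interp s p.
Proof. exact: interp_scale. Qed.

Lemma interpB M (s : nat -> M) p q : is_model T M ->
  interp s (p - q) = interp s p - interp s q.
Proof. by move=> hM; rewrite interp_add// interp_opp. Qed.

Lemma interp0 M (s : nat -> M) : is_model T M -> interp s 0 = 0.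
Proof. exact: interp_cst. Qed.

Fact ler_pnormD p q : pnorm (p + q) <= pnorm p + pnorm q.
Proof.
apply: pnorm_le => M hM s; rewrite interpD// (le_trans (ler_normD _ _))//.
by rewrite lerD// interp_le_pnorm.
Qed.

Fact pnormZ c p : pnorm (c *: p) = `|c| * pnorm p.
Proof.
apply/eqP; rewrite eq_le; apply/andP; split.
  by apply: pnorm_le => M hM s; rewrite interpZ// normrM ler_wpM2l// interp_le_pnorm.
have [->|c0] := eqVneq c 0.
  have [M hM] := theory_model T.
  by rewrite normr0 mul0r (le_trans _ (interp_le_pnorm (fun=> point) _ hM)).
rewrite -ler_pdivlMl ?normr_gt0//; apply: pnorm_le => M hM s.
rewrite ler_pdivlMl ?normr_gt0// -normrM -interpZ//; exact: interp_le_pnorm.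
Qed.

Fact pnorm0_eq0 p : pnorm p = 0 -> p = 0.
Proof.
move=> p0; apply: interp_inj => M hM s; rewrite interp0//.
by apply/eqP; rewrite -normr_le0 -p0 interp_le_pnorm.
Qed.

HB.instance Definition _ := Lmodule_isNormed.Build R P ler_pnormD pnormZ pnorm0_eq0.

End definable_predicates.

Lemma seq_complete (R : realType) (M : pseudoMetricType R) :
  (forall u : nat -> M,
     (forall e : R, 0 < e -> exists N, forall m n, (N <= m)%N -> (N <= n)%N ->
        ball (u m) e (u n)) ->
     exists l : M, forall e : R, 0 < e -> exists N, forall n, (N <= n)%N -> ball l e (u n)) ->
  forall F : set_system M, ProperFilter F -> cauchy F -> exists l : M, F --> l.
Proof.
move=> h F FF /cauchyP Fc.
have inv0 n : 0 < (n.+1%:R^-1 : R) by rewrite invr_gt0.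
have /choice[u hu] n : exists x, F (ball x (n.+1%:R^-1 : R)) by exact: Fc.
have invN (e : R) : 0 < e -> exists N, forall n, (N <= n)%N -> (n.+1%:R^-1 : R) < e.
  by move=> e0; have [N _ hN] := near_infty_natSinv_lt (PosNum e0); exists N => n /hN.
have [e e0|l hl] := h u.
  have [N hN] := invN (e / 2) (divr_gt0 e0 (ltr0n _ 2)); exists N => m n Nm Nn.
  have [z [hz1 hz2]] := filter_ex (filterI (hu m) (hu n)).
  apply: (@le_ball _ _ _ (m.+1%:R^-1 + n.+1%:R^-1)).
    by rewrite (splitr e) lerD// ltW// hN.
  by apply: ball_triangle hz1 _; exact: ball_sym.
exists l; apply/cvg_ballP => e e0.
have e20 : 0 < e / 2 by rewrite divr_gt0.
have [N hN] := invN _ e20; have [K hK] := hl _ e20.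
pose n := maxn N K; apply: filterS (hu n) => z hz.
rewrite (splitr e); apply: ball_triangle (hK n _) _; first exact: leq_maxr.
by apply: le_ball hz; rewrite ltW// hN// leq_maxl.
Qed.

Section banach_algebra.
Context {R : realType} {L : language R} (T : complete_theory L).
Local Notation P := (definable_predicate T).
Implicit Types (p q : P) (phi : formula L) (M : structure L).

Lemma pnormE p : `|p| = pnorm p. Proof. by []. Qed.

Lemma of_formula_dense p (e : R) : 0 < e -> exists phi, `|p - of_formula T phi| <= e.
Proof.
move=> e0; have [N hN] := interp_unif p e0; exists (rep p N).
apply: pnorm_le => M hM s; rewrite interpB// interp_of_formula// distrC.
exact: hN.
Qed.

Lemma predicate_complete (F : set_system P) : ProperFilter F -> cauchy F -> cvg F.
Proof.
move=> FF Fc; apply/cvg_ex; apply: seq_complete F FF Fc => u uc.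
have inv0 n : 0 < (n.+1%:R^-1 : R) by rewrite invr_gt0.
have /choice[phi hphi] n : exists phi, `|u n - of_formula T phi| <= n.+1%:R^-1.
  exact: of_formula_dense.
have invN (e : R) : 0 < e -> exists N, forall n, (N <= n)%N -> (n.+1%:R^-1 : R) < e.
  by move=> e0; have [N _ hN] := near_infty_natSinv_lt (PosNum e0); exists N => n /hN.
have e3 (e : R) : 0 < e -> 0 < e / 3 by move=> ?; rewrite divr_gt0.
have hc : cauchy_formulas T phi.
  move=> e e0; have [N hN] := invN _ (e3 _ e0); have [K hK] := uc _ (e3 _ e0).
  exists (maxn N K) => m n; rewrite !geq_max => /andP[Nm Km] /andP[Nn Kn].
  have := hK _ _ Km Kn; rewrite -ball_normE/= => h1.
  have h2 := le_lt_trans (hphi m) (hN _ Nm).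
  have h3 := le_lt_trans (hphi n) (hN _ Nn).
  rewrite (_ : e = e / 3 + e / 3 + e / 3); last by field.
  apply: le_lt_trans (ltrD (ltrD h2 h1) h3).
  apply: seminorm_le => M hM s; rewrite eval_sub -!(interp_of_formula s _ hM) -interpB//.
  apply: le_trans (interp_le_pnorm s _ hM) _; rewrite -pnormE.
  rewrite (_ : _ - _ = (u m - u n) - (u m - of_formula T (phi m))
     + (u n - of_formula T (phi n))).
    rewrite (le_trans (ler_normD _ _))// lerD2r (le_trans (ler_normB _ _))//.
    by rewrite addrC.
  by ring.
exists (class_of hc) => e e0.
have [N hN] := invN _ (e3 _ e0); have [K hK] := hc _ (e3 _ e0).
exists (maxn N K) => n; rewrite geq_max => /andP[Nn Kn]; rewrite -ball_normE/=.
apply: (@le_lt_trans _ _ (e / 3 + e / 3)); last by lra.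
rewrite -[class_of _](subrK (of_formula T (phi n))) -addrA.
rewrite (le_trans (ler_normD _ _))// lerD//; last first.
  by rewrite distrC (le_trans (hphi _))// ltW// hN.
apply: pnorm_le => M hM s; rewrite interpB// interp_of_formula// interp_class//.
have hd : `|eval M s (phi k) - eval M s (phi n)| @[k --> \oo]
    --> `|limn (fun k => eval M s (phi k)) - eval M s (phi n)|.
  apply: cvg_norm; apply: cvgB; last exact: cvg_cst.
  exact: (@cauchy_formulas_eval _ _ _ _ M s hc hM).
apply: (cvgr_to_le hd); exists K => // k /= Kk; rewrite -eval_sub.
by apply: le_trans (seminorm_ub s _ hM) _; rewrite ltW// hK.
Qed.

HB.instance Definition _ := Uniform_isComplete.Build P predicate_complete.

Lemma pnormM p q : `|p * q| <= `|p| * `|q|.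
Proof.
apply: pnorm_le => M hM s; rewrite interpM// normrM ler_pM//; exact: interp_le_pnorm.
Qed.

End banach_algebra.

(* n : option nat encodes n <= omega: Some k is k, None is omega. *)
Definition tuple_index (n : option nat) : Type := if n is Some k then 'I_k else nat.

Definition in_index (n : option nat) (i : nat) : Prop :=
  if n is Some k then (i < k)%N else True.

Section predicates_in.
Context {R : realType} {L : language R} (T : complete_theory L) (n : option nat).
Local Notation P := (definable_predicate T).
Implicit Types (p q : P) (phi : formula L) (M : structure L).

Definition formulas_in : set (formula L) :=
  [set phi | forall i, free_var phi i -> in_index n i].

Definition predicates_set : set P := closure (of_formula T @` formulas_in).

Definition in_predicates : {pred P} := fun p => `[< predicates_set p >].

Let inE_ p : p \in in_predicates <-> predicates_set p.
Proof. by split=> /asboolP. Qed.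

Let closP p : predicates_set p <->
  forall e : R, 0 < e -> exists2 phi, formulas_in phi & `|p - of_formula T phi| < e.
Proof.
split=> [hp e e0|h].
  have [_ [[phi hphi <-]]] := hp _ (nbhsx_ballx p e e0).
  by rewrite -ball_normE/=; exists phi.
move=> B /nbhs_ballP[e/= e0 hB]; have [phi hphi h1] := h e e0.
by exists (of_formula T phi); split; [exists phi|apply: hB; rewrite -ball_normE].
Qed.

Let of_formula_op phi psi :
  [/\ of_formula T (fadd phi psi) = of_formula T phi + of_formula T psi,
      of_formula T (fmul phi psi) = of_formula T phi * of_formula T psi &
      forall c, of_formula T (fscale c phi) = c *: of_formula T phi].
Proof.
split=> [||c]; apply: interp_inj => M hM s;
by rewrite ?interpD ?interpM ?interpZ// !interp_of_formula//
  ?eval_add ?eval_mul ?eval_scale.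
Qed.

Lemma predicates_subalg_closed : subalg_closed in_predicates.
Proof.
split=> [|c p q|p q].
- apply/inE_; apply: subset_closure; exists (fcst 1) => // i /free_var_cst; exact.
- move=> /inE_/closP hp /inE_/closP hq; apply/inE_/closP => e e0.
  have c0 : 0 < `|c| + 1 by rewrite ltr_wpDl.
  have e20 : 0 < e / 2 by rewrite divr_gt0.
  have [phi hphi h1] := hp _ (divr_gt0 e20 c0); have [psi hpsi h2] := hq _ e20.
  exists (fadd (fscale c phi) psi).
    by move=> i /(free_var_op _ _ _).1[/free_var_scale/hphi|/hpsi].
  have [-> _ _] := of_formula_op (fscale c phi) psi; have [_ _ ->] := of_formula_op phi psi.
  rewrite opprD addrACA -scalerBr (le_lt_trans (ler_normD _ _))// (splitr e).
  rewrite ler_ltD// normrZ; move: h1; rewrite ltr_pdivlMr// => /ltW.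
  by apply: le_trans; rewrite mulrC ler_wpM2l// lerDl.
- move=> /inE_/closP hp /inE_/closP hq; apply/inE_/closP => e e0.
  have e20 : 0 < e / 2 by rewrite divr_gt0.
  have q0 : 0 < `|q| + 1 by rewrite ltr_wpDl.
  have [phi hphi h1] := hp _ (divr_gt0 e20 q0).
  have f0 : 0 < `|of_formula T phi| + 1 by rewrite ltr_wpDl.
  have [psi hpsi h2] := hq _ (divr_gt0 e20 f0).
  exists (fmul phi psi); first by move=> i /(free_var_op _ _ _).2[/hphi|/hpsi].
  have [_ -> _] := of_formula_op phi psi.
  rewrite ltr_pdivlMr// in h1; rewrite ltr_pdivlMr// in h2.
  rewrite (splitr e); apply: le_lt_trans (ltrD h1 h2).
  rewrite (_ : _ - _ = (p - of_formula T phi) * q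
     + (q - of_formula T psi) * of_formula T phi); last by ring.
  rewrite (le_trans (ler_normD _ _))// lerD// (le_trans (pnormM _ _))//.
    by rewrite ler_wpM2l// lerDl.
  by rewrite ler_wpM2l// lerDl.
Qed.

HB.instance Definition _ :=
  GRing.isSubalgClosed.Build R P in_predicates predicates_subalg_closed.

Definition predicates : Type := {p : P | in_predicates p}.
HB.instance Definition _ := SubChoice.on predicates.
HB.instance Definition _ := [SubChoice_isSubComNzRing of predicates by <:].
HB.instance Definition _ := [SubZmodule_isSubLmodule of predicates by <:].
HB.instance Definition _ := [SubNzRing_SubLmodule_isSubLalgebra of predicates by <:].
HB.instance Definition _ := [SubLalgebra_isSubAlgebra of predicates by <:].

Let norm_in (p : predicates) : R := `|val p|.

Let norm_inD (p q : predicates) : norm_in (p + q) <= norm_in p + norm_in q.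
Proof. exact: ler_normD. Qed.

Let norm_inZ c (p : predicates) : norm_in (c *: p) = `|c| * norm_in p.
Proof. exact: normrZ. Qed.

Let norm_in0 (p : predicates) : norm_in p = 0 -> p = 0.
Proof. by move=> /normr0_eq0 p0; apply: val_inj. Qed.

HB.instance Definition _ :=
  Lmodule_isNormed.Build R predicates norm_inD norm_inZ norm_in0.

Lemma interp_in (p : predicates) M (s s' : nat -> M) : is_model T M ->
  (forall i, in_index n i -> s i = s' i) -> interp s (val p) = interp s' (val p).
Proof.
move=> hM ss'; apply/eqP; rewrite -subr_eq0 -normr_le0; apply/ler_addgt0Pl => e e0.
rewrite addr0; have e20 : 0 < e / 2 by rewrite divr_gt0.
have /inE_/closP/(_ _ e20)[phi hphi /ltW h] : val p \in in_predicates := valP p.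
have eqphi : eval M s phi = eval M s' phi by apply: eval_eq => i /hphi/ss'.
rewrite (_ : _ - _ = (interp s (val p) - eval M s phi)
  - (interp s' (val p) - eval M s' phi)); last by rewrite eqphi; ring.
rewrite (splitr e) (le_trans (ler_normB _ _))// lerD//;
by rewrite -(interp_of_formula _ phi hM) -interpB//
  (le_trans (interp_le_pnorm _ _ hM)).
Qed.

End predicates_in.

(* |x p| <= |p| for all p says that the operator norm of x is at most 1. *)
Section types.
Context {R : realType} {L : language R} (T : complete_theory L) (n : option nat).

Definition is_ntype (x : predicates T n -> R) : Prop :=
  [/\ scalar x, {morph x : p q / p * q >-> p * q}, exists p, x p <> 0,
      continuous x & forall p, `|x p| <= `|p|].

Definition type_space : Type := [set x | is_ntype x].

End types.

Section powers.
Context {R : realType}.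

Definition power (M : metricType R) (n : option nat) : Type := tuple_index n -> M.

HB.instance Definition _ (M : metricType R) (n : option nat) :=
  gen_eqMixin (power M n).
HB.instance Definition _ (M : metricType R) (n : option nat) :=
  gen_choiceMixin (power M n).

Definition weighted_dist (M : metricType R) (x y : nat -> M) (i : nat) : R :=
  2 ^- i * Num.min 1 (mdist (x i) (y i)).

Definition power_dist (M : metricType R) (n : option nat) :
    power M n -> power M n -> R :=
  match n with
  | Some k => fun x y => sum_dist x y
  | None => fun x y => limn (series (weighted_dist x y))
  end.

Variable M : metricType R.

Let weighted_ge0 (x y : nat -> M) i : 0 <= weighted_dist x y i.
Proof. by rewrite mulr_ge0 ?invr_ge0 ?exprn_ge0// le_min ler01 mdist_ge0. Qed.

Let weighted_cvg (x y : nat -> M) : cvgn (series (weighted_dist x y)).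
Proof.
apply: (@series_le_cvg _ _ (geometric 1 (2^-1))) => //.
- by move=> i; rewrite /geometric/= mul1r exprn_ge0// invr_ge0.
- by move=> i; rewrite /geometric/= mul1r exprVn ler_piMr ?invr_ge0 ?exprn_ge0// ge_min lexx.
- by apply: is_cvg_geometric_series; rewrite ger0_norm ?invr_ge0// invf_lt1// ltr1n.
Qed.

Let power_distxx n (x : power M n) : power_dist x x = 0.
Proof.
case: n x => [k|] x /=.
  by rewrite /sum_dist big1// => i _; rewrite mdistxx.
rewrite (_ : weighted_dist x x = fun=> 0); last first.
  by apply/funext => i; rewrite /weighted_dist mdistxx min_r// mulr0.
rewrite (_ : series _ = fun=> 0) ?lim_cst//.
by apply/funext => m; rewrite /series/= big1.
Qed.

Let power_dist_eq0 n (x y : power M n) : power_dist x y = 0 -> x = y.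
Proof.
case: n x y => [k|] x y /= h.
  apply/funext => i; apply: mdist_positivity.
  move: h; rewrite /sum_dist => /eqP; rewrite psumr_eq0; last first.
    by move=> *; exact: mdist_ge0.
  by move=> /allP/(_ i (mem_index_enum i))/eqP.
apply/funext => i; apply: mdist_positivity; apply/eqP.
have : weighted_dist x y i <= 0.
  rewrite -h; apply: (@le_trans _ _ (series (weighted_dist x y) i.+1)).
    by rewrite /series/= big_nat_recr//= lerDr sumr_ge0.
  apply: nondecreasing_cvgn_le => //.
  by apply/nondecreasing_seqP => j; rewrite /series/= big_nat_recr//= lerDl.
rewrite /weighted_dist pmulr_rle0 ?invr_gt0 ?exprn_gt0//.
by rewrite ge_min leNgt ltr01/= => h0; rewrite eq_le h0 mdist_ge0.
Qed.

Let power_dist_sym n (x y : power M n) : power_dist x y = power_dist y x.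
Proof.
case: n x y => [k|] x y /=; first by apply: eq_bigr => i _; rewrite metric_sym.
by congr (limn (series _)); apply/funext => i; rewrite /weighted_dist metric_sym.
Qed.

Let power_dist_triangle n (y x z : power M n) :
  power_dist x z <= power_dist x y + power_dist y z.
Proof.
case: n x y z => [k|] x y z /=.
  by rewrite /sum_dist -big_split/= ler_sum// => i _; exact: metric_triangle.
rewrite -limD//; apply: ler_lim => //; first exact: is_cvgD.
apply: nearW => m /=; rewrite /series/= [leRHS](_ : _ = \sum_(0 <= i < m)
  (weighted_dist x y i + weighted_dist y z i)); last by rewrite big_split.
apply: ler_sum => i _; rewrite -mulrDr ler_wpM2l ?invr_ge0 ?exprn_ge0//.
have := metric_triangle (x i) (y i) (z i).
have := mdist_ge0 (x i) (y i); have := mdist_ge0 (y i) (z i).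
move: (mdist (x i) (z i)) (mdist (x i) (y i)) (mdist (y i) (z i)) => a b c.
by rewrite !minElt; case: (ltP 1 a); case: (ltP 1 b); case: (ltP 1 c); lra.
Qed.

HB.instance Definition _ (n : option nat) := isMetric.Build R (power M n)
  (@power_distxx n) (@power_dist_eq0 n) (@power_dist_sym n) (@power_dist_triangle n).

End powers.

Section orbits.
Context {R : realType} {L : language R} (M : structure L).

Definition automorphism (g : M -> M) : Prop :=
  [/\ bijective g,
      forall x y, mdist (g x) (g y) = mdist x y,
      forall (f : fsym L) x, g (finterp M f x) = finterp M f (g \o x) &
      forall (r : rsym L) x, rinterp M r (g \o x) = rinterp M r x].

Variable n : option nat.

Definition aut_orbit (a : power M n) : set (power M n) :=
  [set b | exists2 g, automorphism g & b = g \o a].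

Definition orbit_closure_space : Type :=
  range (fun a : power M n => closure (aut_orbit a)).

Definition orbit_closure (a : power M n) : orbit_closure_space :=
  exist _ (closure (aut_orbit a)) (mem_set (imageT _ a)).

End orbits.

Section type_of_tuple.
Context {R : realType} {L : language R}.

(* By interp_in the padding is irrelevant on predicates T n. *)
Definition pad (M : structure L) (n : option nat) : power M n -> nat -> M :=
  match n with
  | Some k => fun a i => if insub i is Some j then a j else point
  | None => fun a => a
  end.

Definition tp (T : complete_theory L) (M : structure L) (n : option nat)
  (a : power M n) : predicates T n -> R := fun p => interp (pad a) (val p).

Definition eliminates_quantifiers (T : complete_theory L) : Prop :=
  dense (of_formula T @` [set phi | quantifier_free phi]).

End type_of_tuple.

Section measure_algebra_language.
Variable R : realType.

Let id_cvg0 : id r @[r --> 0^'+] --> (0 : R).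
Proof. exact: cvg_at_right_filter. Qed.

Definition lipschitz_modulus : modulus R :=
  @Modulus R id erefl (fun _ _ _ rs => rs) id_cvg0.

Inductive malg_fsym := MEmpty | MFull | MUnion | MInter | MSymDiff.
Inductive malg_rsym := MMeasure.

Definition malg_language : language R :=
  @Language R malg_fsym
    (fun f => match f with MEmpty | MFull => 0 | _ => 2 end)%N
    (fun=> lipschitz_modulus)
    malg_rsym (fun=> 1%N) (fun=> lipschitz_modulus) (fun=> 1) (fun=> ltr01) 1 ltr01.

End measure_algebra_language.

Section measure_algebra.
Context d (X : measurableType d) (R : realType) (mu : probability X R).

Definition event : Type := (measurable : set (set X)).
HB.instance Definition _ := Choice.on event.

Definition null_equal (A B : event) : bool :=
  mu (set_val A `+` set_val B) == 0%E.

Let m (A : set X) : R := fine (mu A).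

Let mfin (A : set X) : measurable A -> (m A)%:E = mu A.
Proof. by move=> mA; rewrite fineK// fin_num_measure. Qed.

Let m0 : m set0 = 0. Proof. by rewrite /m measure0. Qed.

Let m_ge0 A : 0 <= m A. Proof. by rewrite fine_ge0. Qed.

Let m_le1 A : measurable A -> m A <= 1.
Proof. by move=> mA; rewrite -lee_fin mfin// probability_le1. Qed.

Let m_le A B : measurable A -> measurable B -> A `<=` B -> m A <= m B.
Proof. by move=> mA mB AB; rewrite -lee_fin !mfin// le_measure// inE. Qed.

Let m_leU A B C : measurable A -> measurable B -> measurable C ->
  A `<=` B `|` C -> m A <= m B + m C.
Proof.
move=> mA mB mC ABC.
apply: (le_trans (m_le mA (measurableU _ _ mB mC) ABC)).
by rewrite -lee_fin EFinD !mfin//; [exact: measureU2|exact: measurableU].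
Qed.

Let mY (A B : set X) : measurable A -> measurable B -> measurable (A `+` B).
Proof. by move=> mA mB; apply: measurableU; exact: measurableD. Qed.

Let mD (A B C : set X) : measurable A -> measurable B -> measurable C ->
  m (A `+` C) <= m (A `+` B) + m (B `+` C).
Proof.
move=> mA mB mC; apply: m_leU; try exact: mY.
by move=> x /=; have := EM (B x); tauto.
Qed.

Let valM (A : event) : measurable (set_val A). Proof. exact: set_valP. Qed.

Let null_equalE (A B : event) : null_equal A B = (m (set_val A `+` set_val B) == 0).
Proof. by rewrite /null_equal -mfin ?eqe//; apply: mY. Qed.

Let null_equal_refl : reflexive null_equal.
Proof. by move=> A; rewrite null_equalE setYK m0. Qed.

Let null_equal_sym : symmetric null_equal.
Proof. by move=> A B; rewrite !null_equalE setYC. Qed.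

Let null_equal_trans : transitive null_equal.
Proof.
move=> B A C; rewrite !null_equalE => /eqP AB /eqP BC; rewrite eq_le m_ge0 andbT.
by rewrite (le_trans (mD (valM A) (valM B) (valM C)))// AB BC addr0.
Qed.

Canonical null_equal_canonical :=
  EquivRel null_equal null_equal_refl null_equal_sym null_equal_trans.

Local Open Scope quotient_scope.

Definition malg : Type := {eq_quot null_equal}.
HB.instance Definition _ := Choice.on malg.
HB.instance Definition _ := EqQuotient.on malg.

Definition malg_set (a : malg) : set X := set_val (repr a).

Lemma malg_setP (a : malg) : measurable (malg_set a). Proof. exact: valM. Qed.

Definition malg_class (A : set X) (mA : measurable A) : malg :=
  \pi_malg (exist _ A (mem_set mA) : event).

Let malg_classK (A : set X) (mA : measurable A) :
  m (malg_set (malg_class mA) `+` A) = 0.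
Proof.
rewrite /malg_set /malg_class; case: piP => B /eqmodP/=.
by rewrite null_equalE => /eqP <-; rewrite setYC.
Qed.

Definition malg_dist (a b : malg) : R := fine (mu (malg_set a `+` malg_set b)).

Let malg_dist_class (A B : set X) (mA : measurable A) (mB : measurable B) :
  malg_dist (malg_class mA) (malg_class mB) <= m (A `+` B).
Proof.
have mcA := malg_setP (malg_class mA); have mcB := malg_setP (malg_class mB).
apply: (le_trans (mD mcA mA mcB)); rewrite malg_classK add0r.
by apply: (le_trans (mD mA mB mcB)); rewrite [_ `+` malg_set _]setYC malg_classK addr0.
Qed.

Let malg_distxx a : malg_dist a a = 0.
Proof. by rewrite /malg_dist setYK -/(m _) m0. Qed.

Let malg_dist_eq0 a b : malg_dist a b = 0 -> a = b.
Proof.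
move=> ab; rewrite -[a]reprK -[b]reprK; apply/eqmodP.
by rewrite /= null_equalE; apply/eqP.
Qed.

Let malg_dist_sym a b : malg_dist a b = malg_dist b a.
Proof. by rewrite /malg_dist setYC. Qed.

Let malg_dist_triangle b a c : malg_dist a c <= malg_dist a b + malg_dist b c.
Proof. exact: mD (malg_setP a) (malg_setP b) (malg_setP c). Qed.

HB.instance Definition _ := isPointed.Build malg (malg_class measurable0).
HB.instance Definition _ := isMetric.Build R malg
  malg_distxx malg_dist_eq0 malg_dist_sym malg_dist_triangle.

Let flip (A : nat -> set X) x k j : (k <= j)%N -> ~ (A k x <-> A j x) ->
  (\bigcup_i (A (k + i)%N `+` A (k + i.+1)%N)) x.
Proof.
move=> kj; rewrite -(subnKC kj); elim: (j - k)%N => [|i IH].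
  by rewrite addn0 => h; exfalso; apply: h.
move=> h; have [hi|hi] := pselect (A k x <-> A (k + i)%N x).
  by exists i => //=; have := EM (A (k + i)%N x); have := EM (A (k + i.+1)%N x); tauto.
exact: IH.
Qed.

Let malg_limit (A : nat -> set X) k : (forall i, measurable (A i)) ->
  (forall i, m (A i `+` A i.+1) <= 2 ^- i.+1) ->
  m (lim_sup_set A `+` A k) <= 2 ^- k.
Proof.
move=> mA hA.
have mL : measurable (lim_sup_set A).
  by apply: bigcap_measurable => // n _; apply: bigcup_measurable => // j _; exact: mA.
pose D i := A (k + i)%N `+` A (k + i.+1)%N.
have mDi i : measurable (D i) by exact: mY.
have sub : lim_sup_set A `+` A k `<=` \bigcup_i D i.
  move=> x /= [[Lx nAx]|[Ax nLx]].
    have [j /= kj Ajx] := Lx k I.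
    by apply: (flip kj); tauto.
  have [n hn] : exists n, forall j, (n <= j)%N -> ~ A j x.
    move: nLx => /existsNP[n] /not_implyP[_ hn]; exists n => j nj Ajx; apply: hn.
    by exists j.
  have := hn (maxn k n) (leq_maxr _ _).
  by move=> nA; apply: (flip (leq_maxl k n)); tauto.
rewrite -lee_fin mfin; last exact: mY.
apply: (@le_trans _ _ (\sum_(0 <= i <oo) mu (D i))%E).
  by apply: measure_sigma_subadditive => //; [exact: mY].
have e0 : 0 <= 2 ^- k :> R by rewrite invr_ge0 exprn_ge0.
have := @epsilon_trick R (fun=> 0%E) (2 ^- k) xpredT (fun=> lexx _) e0.
have z0 : (\sum_(0 <= i <oo) 0 = 0 :> \bar R)%E by rewrite eseries0.
rewrite z0 add0e; apply: le_trans.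
apply: lee_nneseries => // i _; rewrite add0e -mfin// lee_fin /D addnS.
apply: (le_trans (hA _)); rewrite natrX -invfM -exprD addnS lexx//.
Qed.

Let malg_complete (F : set_system malg) : ProperFilter F -> cauchy F -> cvg F.
Proof.
move=> FF Fc; apply/cvg_ex; apply: seq_complete F FF Fc => u uc.
have ucd (e : R) : 0 < e -> exists N, forall m n, (N <= m)%N -> (N <= n)%N ->
    malg_dist (u m) (u n) < e.
  move=> /uc[N hN]; exists N => i j Ni Nj; have := hN _ _ Ni Nj.
  by rewrite ballEmdist.
have p0 k : 0 < 2 ^- k :> R by rewrite invr_gt0 exprn_gt0.
have /choice[N hN] k := ucd _ (p0 k.+1).
pose n k := (\sum_(j < k.+1) N j)%N.
have Nn k i : (k <= i)%N -> (N k <= n i)%N.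
  rewrite -ltnS => ki; rewrite /n (bigD1 (Ordinal ki))//=; exact: leq_addr.
pose A k := malg_set (u (n k)).
have mA k : measurable (A k) by exact: malg_setP.
have hA k : m (A k `+` A k.+1) <= 2 ^- k.+1.
  by apply/ltW; apply: hN; exact: Nn.
have mL : measurable (lim_sup_set A).
  by apply: bigcap_measurable => // j _; apply: bigcup_measurable => // i _; exact: mA.
exists (malg_class mL) => e e0.
have [k hk] : exists k, 2 ^- k < e / 2 :> R.
  have [k _ hk] := near_infty_natSinv_expn_lt (PosNum (divr_gt0 e0 (ltr0n _ 2))).
  by exists k; have := hk k (leqnn k); rewrite /= div1r.
exists (N k) => j Nj; rewrite ballEmdist/=.
have h1 : malg_dist (malg_class mL) (u (n k)) <= 2 ^- k.
  apply: (le_trans (mD (malg_setP _) mL (malg_setP _))).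
  by rewrite malg_classK add0r; exact: malg_limit.
have h2 : malg_dist (u (n k)) (u j) < 2 ^- k.
  apply: (lt_le_trans (hN k _ _ (Nn k k (leqnn k)) Nj)).
  by rewrite lef_pV2 ?posrE ?exprn_gt0// ler_eXn2l ?ltr1n.
apply: (le_lt_trans (metric_triangle _ (u (n k)) _)); rewrite (splitr e).
by apply: ltrD; [exact: le_lt_trans hk|exact: lt_trans hk].
Qed.

HB.instance Definition _ := Uniform_isComplete.Build malg malg_complete.

Definition malg_union (a b : malg) : malg :=
  malg_class (measurableU _ _ (malg_setP a) (malg_setP b)).
Definition malg_inter (a b : malg) : malg :=
  malg_class (measurableI _ _ (malg_setP a) (malg_setP b)).
Definition malg_symdiff (a b : malg) : malg :=
  malg_class (mY (malg_setP a) (malg_setP b)).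
Definition malg_measure (a : malg) : R := fine (mu (malg_set a)).

Definition malg_finterp (f : malg_fsym) :
    ('I_(farity (l := malg_language R) f) -> malg) -> malg :=
  match f with
  | MEmpty => fun=> malg_class measurable0
  | MFull => fun=> malg_class measurableT
  | MUnion => fun x => malg_union (x ord0) (x ord_max)
  | MInter => fun x => malg_inter (x ord0) (x ord_max)
  | MSymDiff => fun x => malg_symdiff (x ord0) (x ord_max)
  end.

Let malg_op_le (op : set X -> set X -> set X)
    (mop : forall A B, measurable A -> measurable B -> measurable (op A B))
    (hop : forall A A' B B', op A B `+` op A' B' `<=` (A `+` A') `|` (B `+` B'))
    (x y : 'I_2 -> malg) :
  malg_dist (malg_class (mop _ _ (malg_setP (x ord0)) (malg_setP (x ord_max))))
            (malg_class (mop _ _ (malg_setP (y ord0)) (malg_setP (y ord_max))))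
    <= sum_dist x y.
Proof.
apply: (le_trans (malg_dist_class _ _)); rewrite /sum_dist !big_ord_recl big_ord0 addr0.
rewrite (_ : lift ord0 ord0 = ord_max); last exact: val_inj.
by apply: m_leU; [apply: mY; apply: mop|apply: mY|apply: mY|exact: hop]; exact: malg_setP.
Qed.

Let malg_diam : forall a b : malg, mdist a b <= 1.
Proof.
by move=> a b; apply: m_le1; apply: mY; exact: malg_setP.
Qed.

Let malg_finterp_modulus : forall (f : malg_fsym) x y,
  mdist (@malg_finterp f x) (@malg_finterp f y) <= sum_dist x y.
Proof.
case=> x y /=.
  + by rewrite mdistxx; apply: sumr_ge0 => i _; exact: mdist_ge0.
  + by rewrite mdistxx; apply: sumr_ge0 => i _; exact: mdist_ge0.
  + apply: malg_op_le => A A' B B' z /=.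
    by have := EM (A z); have := EM (A' z); have := EM (B z); have := EM (B' z); tauto.
  + apply: malg_op_le => A A' B B' z /=.
    by have := EM (A z); have := EM (A' z); have := EM (B z); have := EM (B' z); tauto.
  + apply: malg_op_le => A A' B B' z /=.
    by have := EM (A z); have := EM (A' z); have := EM (B z); have := EM (B' z); tauto.
Qed.

Let malg_measure_itv : forall (r : malg_rsym) (x : 'I_1 -> malg),
  0 <= malg_measure (x ord0) <= 1.
Proof.
move=> r x; rewrite m_ge0/=; apply: m_le1; exact: malg_setP.
Qed.

Let malg_measure_modulus : forall (r : malg_rsym) (x y : 'I_1 -> malg),
  `|malg_measure (x ord0) - malg_measure (y ord0)| <= sum_dist x y.
Proof.
move=> r x y /=; rewrite /sum_dist big_ord_recl big_ord0 addr0.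
  have hx := malg_setP (x ord0); have hy := malg_setP (y ord0).
  rewrite ler_norml lerBrDl addrC -lerBrDl opprK lerBlDl; apply/andP; split.
    by apply: m_leU => //; [exact: mY|move=> z /=; have := EM (malg_set (x ord0) z); tauto].
  by apply: m_leU => //; [exact: mY|move=> z /=; have := EM (malg_set (y ord0) z); tauto].
Qed.

Definition MAlg : structure (malg_language R) :=
  @Structure R (malg_language R) malg malg_finterp
    (fun _ x => malg_measure (x ord0))
    malg_diam malg_finterp_modulus malg_measure_itv malg_measure_modulus.

End measure_algebra.

Section unit_interval.
Variable R : realType.

Definition unit_interval_points : Type := `[0 : R, 1]%classic.

Let zero_in : `[0 : R, 1]%classic 0.
Proof. by rewrite /= in_itv/= lexx ler01. Qed.

HB.instance Definition _ := Choice.on unit_interval_points.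
HB.instance Definition _ :=
  isPointed.Build unit_interval_points (exist _ 0 (mem_set zero_in)).

Definition in_line (x : unit_interval_points) : measurableTypeR R := set_val x.

(* [0,1] with its Borel sets *)
Definition unit_interval := g_sigma_algebra_preimageType in_line.

Definition lebesgue01 (A : set unit_interval) : \bar R :=
  lebesgue_measure (in_line @` A).

Let in_line_inj : injective in_line.
Proof. by move=> x y h; apply: val_inj. Qed.

Let in_line_measurable (A : set unit_interval) :
  measurable A -> measurable (in_line @` A).
Proof.
move=> [B mB <-]; rewrite setTI.
rewrite (_ : in_line @` _ = B `&` `[0, 1]%classic); first exact: measurableI.
apply/seteqP; split=> [_ [x /= Bx <-]|x [Bx x01]].
  by split=> //; exact: (@set_valP _ `[0 : R, 1]%classic x).
by exists (exist _ x (mem_set x01)).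
Qed.

Let lebesgue01_0 : lebesgue01 set0 = 0%E.
Proof. by rewrite /lebesgue01 image_set0 measure0. Qed.

Let lebesgue01_ge0 A : (0 <= lebesgue01 A)%E.
Proof. exact: measure_ge0. Qed.

Let lebesgue01_sigma : semi_sigma_additive lebesgue01.
Proof.
move=> F mF tF mU; rewrite /lebesgue01 image_bigcup.
apply: measure_semi_sigma_additive.
- by move=> i; exact: in_line_measurable.
- apply/trivIsetP => i j _ _ ij; rewrite -subset0 => _ [[x Fx <-] [y Fy /in_line_inj xy]].
  move/trivIsetP: tF => /(_ i j I I ij); rewrite -subset0 => /(_ x); apply.
  by split=> //; rewrite -xy.
- by rewrite -image_bigcup; exact: in_line_measurable.
Qed.

HB.instance Definition _ := isMeasure.Build _ unit_interval R lebesgue01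
  lebesgue01_0 lebesgue01_ge0 lebesgue01_sigma.

Let lebesgue01_1 : lebesgue01 setT = 1%E.
Proof.
rewrite /lebesgue01 (_ : _ @` _ = `[0, 1]%classic).
  by rewrite lebesgue_measure_itv/= lte_fin ltr01 sube0.
apply/seteqP; split=> [_ [x _ <-]|x x01].
  exact: (@set_valP _ `[0 : R, 1]%classic x).
by exists (exist _ x (mem_set x01)).
Qed.

HB.instance Definition _ := Measure_isProbability.Build _ unit_interval R
  lebesgue01 lebesgue01_1.

End unit_interval.

(* Main.v *)
Require Import Defs.
From HB Require Import structures.
From mathcomp Require Import all_boot all_order all_algebra fingroup perm.
From mathcomp Require Import all_classical all_reals all_analysis.
From mathcomp Require Import measurable_realfun.
From mathcomp Require Import ring lra.
(* Imported again because [eval] is shadowed by all_analysis. *)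
Require Import Defs.

Set Implicit Arguments.
Unset Strict Implicit.
Unset Printing Implicit Defensive.

Import Order.TTheory GRing.Theory Num.Theory.
Import numFieldNormedType.Exports.

Local Open Scope classical_set_scope.
Local Open Scope ring_scope.

(* Call M finitely homogeneous when, for every k, finitely many quantifier-free
   formulas decide, up to a small error, whether two k-tuples can be brought close
   to each other by an automorphism.

   Such an M has both properties of the theorem.  Formulas are uniformly continuous
   and invariant under automorphisms, so the value of any formula is, up to a
   uniform error, a function of the values of these quantifier-free formulas; it
   can be extended to a continuous connective, which eliminates the quantifiers.
   Two tuples of the same type are moved arbitrarily close to each other, so they
   have the same orbit closure.  An n-type is a character of the algebra of
   predicates, hence it is approximately realized in M on finitely many formulas;
   correcting better and better realizations by automorphisms gives a Cauchy
   sequence, whose limit realizes the type.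

   The measure algebra of [0, 1] is finitely homogeneous for the measures of the
   2^k minterms of a k-tuple: sets are approximated by unions of cells
   [j/N, (j+1)/N[, permutations of the cells are measure preserving, and two
   colorings of the cells with nearly the same number of cells of each color agree
   on most cells after a permutation. *)

(** * Uniform continuity and automorphisms *)

(** The minimum of the witnesses works, since each [P i] passes to smaller positive radii; starting
    the minimum at 1 keeps it positive when [I] is empty. *)
Lemma uniform_pos (R : realType) (I : finType) (P : I -> R -> Prop) :
  (forall i d d', 0 < d' -> d' <= d -> P i d -> P i d') ->
  (forall i, exists2 d, 0 < d & P i d) -> exists2 d, 0 < d & forall i, P i d.
Proof.
move=> Ple /(_ _)/cid2-/all_sig2[f f0 Pf].
exists (\big[Num.min/1]_i f i); first by apply/bigmin_gtP; split.
move=> i; apply: (Ple _ (f i)) => //; last exact: bigmin_le.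
by apply/bigmin_gtP; split.
Qed.

Lemma mx_norm_ge_coord (R : realType) m (v : 'rV[R]_m) j : `|v ord0 j| <= `|v|.
Proof.
by rewrite [leRHS]/Num.norm /= mx_normrE; apply/bigmax_geP; right => /=; exists (ord0, j).
Qed.

Lemma lipschitz_continuous (R : realType) m (u : 'rV[R]_m -> R) (K : R) : 0 < K ->
  (forall v w, `|u v - u w| <= K * `|v - w|) -> continuous u.
Proof.
move=> K0 uK v; apply/(@cvgrPdist_le _ _ _ (nbhs v)) => e e0.
have eK : 0 < e / K by rewrite divr_gt0.
apply/nbhs_ballP; exists (e / K) => // w; rewrite -ball_normE /= => vw.
by apply: le_trans (uK v w) _; rewrite mulrC -ler_pdivlMr// ltW.
Qed.

Section automorphisms.
Context {R : realType} {L : language R} (M : structure L).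

Lemma automorphism_id : @automorphism R L M id.
Proof. by split=> //; exists id. Qed.

Lemma automorphism_comp (g h : M -> M) :
  automorphism g -> automorphism h -> automorphism (g \o h).
Proof.
move=> [bg dg fg rg] [bh dh fh rh]; split.
- exact: bij_comp.
- by move=> x y; rewrite /= dg dh.
- by move=> f x; rewrite /= fh fg.
- by move=> r x; rewrite -compA rg rh.
Qed.

Lemma eval_term_automorphism (g : M -> M) (s : nat -> M) (t : term L) :
  automorphism g -> eval_term M (g \o s) t = g (eval_term M s t).
Proof.
case=> _ _ fg _; elim: t => //= f a IH.
by rewrite fg; congr finterp; apply/funext => k; rewrite IH.
Qed.

Lemma update_comp (g : M -> M) (s : nat -> M) i x :
  update (g \o s) i (g x) = g \o update s i x.
Proof. by apply/funext => j; rewrite /update /=; case: ifP. Qed.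

Lemma eval_automorphism (g : M -> M) (s : nat -> M) (phi : formula L) :
  automorphism g -> eval M (g \o s) phi = eval M s phi.
Proof.
move=> ag; have [bg dg fg rg] := ag.
(* Surjectivity of [g] handles the quantifiers: reindexing by [g] and its inverse leaves the set of
   values unchanged. *)
have range_update psi (s' : nat -> M) i :
    (forall s'', eval M (g \o s'') psi = eval M s'' psi) ->
    range (fun x => eval M (update (g \o s') i x) psi) =
    range (fun x => eval M (update s' i x) psi).
  move=> IH; have [h gh hg] := bg.
  apply/seteqP; split=> _ [x _ <-].
    by exists (h x) => //; rewrite -IH -update_comp hg.
  by exists (g x) => //; rewrite update_comp IH.
elim: phi s => [r a|t t'|k u cu a IH|i psi IH|i psi IH] s /=.
- rewrite -(rg r (fun k => eval_term M s (a k))); congr rinterp; apply/funext => k.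
  exact: eval_term_automorphism.
- by rewrite !eval_term_automorphism.
- by congr u; apply/rowP => j; rewrite !mxE IH.
- by rewrite range_update.
- by rewrite range_update.
Qed.

End automorphisms.

Section free_variable_bound.
Context {R : realType} {L : language R}.

Lemma ord_bound k (P : 'I_k -> nat -> Prop) :
  (forall j, exists m, forall i, P j i -> (i < m)%N) ->
  exists m, forall j i, P j i -> (i < m)%N.
Proof.
move=> /choice[m hm]; exists (\max_j m j)%N => j i /hm h.
exact: leq_trans h (leq_bigmax _).
Qed.

Lemma term_var_bound (t : term L) : exists m, forall i, term_var t i -> (i < m)%N.
Proof.
elim: t => [j|f a /ord_bound[m hm]] /=; first by exists j.+1 => i ->.
by exists m => i [k /hm].
Qed.

Lemma free_var_bound (phi : formula L) :
  exists m, forall i, free_var phi i -> (i < m)%N.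
Proof.
elim: phi => [r a|t t'|k u cu a /ord_bound[m hm]|j psi [m hm]|j psi [m hm]] /=.
- have [m hm] := ord_bound (fun k => term_var_bound (a k)).
  by exists m => i [k /hm].
- have [m hm] := term_var_bound t; have [m' hm'] := term_var_bound t'.
  by exists (maxn m m') => i [/hm h|/hm' h]; rewrite leq_max h ?orbT.
- by exists m => i [j /hm].
- by exists m => i [_ /hm].
- by exists m => i [_ /hm].
Qed.

End free_variable_bound.

(** The near-covering form of compactness, applied to the filter of radii tending to 0, gives one
    radius valid around all points of [K]. The local estimates hold on balls of the whole space, so
    [w] may leave [K]. *)
Lemma compact_uniform_continuity (R : realType) k (u : 'rV[R]_k -> R)
    (K : set 'rV[R]_k) (e : R) : continuous u -> compact K -> 0 < e ->
  exists2 d, 0 < d &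
    forall v w : 'rV[R]_k, K v -> (forall j, `|v ord0 j - w ord0 j| < d) -> `|u v - u w| <= e.
Proof.
move=> cu /compact_near_coveringP cK e0; have e20 : 0 < e / 2 by rewrite divr_gt0.
pose P (d : R) v := forall w, ball v d w -> `|u v - u w| <= e.
have [v Kv|d /= d0 hd] := cK R (0^'+) P _.
  have /cvgrPdist_le/(_ _ e20)/nbhs_ballP[d /= d0 hd] := cu v.
  have d20 : 0 < d / 2 by rewrite divr_gt0.
  exists (ball v (d / 2), [set r | r < d / 2]).
    split; first exact: nbhsx_ballx.
    exact: nbhs_right_lt.
  move=> [v' r] /= [vv' rd] w v'w.
  rewrite -[_ - _](subrKA (u v)) (splitr e) (le_trans (ler_normD _ _))// lerD//.
    rewrite distrC hd//; apply: le_ball vv'.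
    by rewrite ler_pdivrMr// ler_peMr ?(ltW d0)// ler1n.
  apply: hd; rewrite (splitr d); apply: ball_triangle vv' _.
  by apply: le_ball v'w; exact: ltW.
exists (d / 2); first by rewrite divr_gt0.
move=> v w Kv vw; apply: (hd (d / 2)) => //=.
- rewrite sub0r normrN gtr0_norm ?divr_gt0//.
  by rewrite ltr_pdivrMr// ltr_pMr// ltr1n.
- by rewrite divr_gt0.
split=> [|i j]; first by rewrite divr_gt0.
by rewrite -ball_normE /= ord1; exact: vw.
Qed.

Lemma sup_dist_le (R : realType) (A : Type) (f g : A -> R) (e : R) (a : A) :
  has_ubound (range f) -> has_ubound (range g) ->
  (forall x, `|f x - g x| <= e) -> `|sup (range f) - sup (range g)| <= e.
Proof.
have le_sup (f' g' : A -> R) : has_ubound (range g') ->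
    (forall x, `|f' x - g' x| <= e) -> sup (range f') <= sup (range g') + e.
  move=> ug fg; apply: ge_sup; first by exists (f' a), a.
  move=> _ [x _ <-]; have := fg x; rewrite ler_distlC => /andP[_ fx].
  have : g' x <= sup (range g') by apply: ub_le_sup => //; exists x.
  by have := ler_norm (f' x - g' x); have := fg x; lra.
move=> uf ug fg; rewrite ler_norml.
have h1 := le_sup f g ug fg.
have h2 : sup (range g) <= sup (range f) + e.
  by apply: le_sup => // x; rewrite distrC.
by apply/andP; split; lra.
Qed.

Lemma inf_dist_le (R : realType) (A : Type) (f g : A -> R) (e : R) (a : A) :
  has_lbound (range f) -> has_lbound (range g) ->
  (forall x, `|f x - g x| <= e) -> `|inf (range f) - inf (range g)| <= e.
Proof.
move=> lf lg fg; rewrite /inf -opprD normrN !image_comp.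
apply: sup_dist_le => //.
- by have [B hB] := lf; exists (- B) => _ [x _ <-]; rewrite lerN2 hB//; exists x.
- by have [B hB] := lg; exists (- B) => _ [x _ <-]; rewrite lerN2 hB//; exists x.
- by move=> x /=; rewrite -opprD normrN.
Qed.

Lemma modulus_small (R : realType) (w : modulus R) (e : R) : 0 < e ->
  exists2 d, 0 < d & forall r, 0 <= r -> r < d -> w r < e.
Proof.
move=> e0; have /cvgrPdist_lt/(_ _ e0)[d /= d0 hd] := @modulus_cvg0 _ w.
exists d => // r; rewrite le_eqVlt => /predU1P[<- _|r0 rd]; first by rewrite modulus0.
have := hd r; rewrite /= !sub0r !normrN gtr0_norm// => /(_ rd r0).
exact/le_lt_trans/ler_norm.
Qed.

Section uniform_continuity.
Context {R : realType} {L : language R} (M : structure L).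

Lemma sum_dist_small k (e : R) : 0 < e ->
  exists2 d, 0 < d & forall x y : 'I_k -> M, (forall i, mdist (x i) (y i) < d) ->
    sum_dist x y < e.
Proof.
move=> e0; have k0 : 0 < k%:R + 1 :> R by rewrite ltr_wpDl.
exists (e / (k%:R + 1)); first by rewrite divr_gt0.
move=> x y xy; apply: (@le_lt_trans _ _ (\sum_(i < k) e / (k%:R + 1))).
  by apply: ler_sum => i _; exact: ltW.
rewrite sumr_const card_ord -[ltLHS]mulr_natr -mulrA gtr_pMr// mulrC ltr_pdivrMr//.
by rewrite mul1r ltrDl.
Qed.

Lemma sum_dist_ge0 k (x y : 'I_k -> M) : 0 <= sum_dist x y.
Proof. by apply: sumr_ge0 => i _; exact: mdist_ge0. Qed.

Lemma modulus_sum_dist_small (w : modulus R) k (e : R) : 0 < e ->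
  exists2 d, 0 < d & forall x y : 'I_k -> M, (forall i, mdist (x i) (y i) < d) ->
    w (sum_dist x y) < e.
Proof.
move=> /(modulus_small w)[d d0 wd]; have [d' d'0 hd'] := @sum_dist_small k _ d0.
by exists d' => // x y /hd' xy; apply: wd => //; exact: sum_dist_ge0.
Qed.

Lemma eval_term_uniform (t : term L) (e : R) : 0 < e ->
  exists2 d, 0 < d & forall s s' : nat -> M,
    (forall i, term_var t i -> mdist (s i) (s' i) < d) ->
    mdist (eval_term M s t) (eval_term M s' t) < e.
Proof.
elim: t e => [j|f a IH] e e0 /=; first by exists e => // s s'; apply.
have [d d0 hd] := modulus_sum_dist_small (fmodulus f) (farity f) e0.
pose P (k : 'I_(farity f)) r := forall s s' : nat -> M,
  (forall i, term_var (a k) i -> mdist (s i) (s' i) < r) ->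
  mdist (eval_term M s (a k)) (eval_term M s' (a k)) < d.
have [k r r' _ rr' Pr s s' h|k|r r0 Pr] := @uniform_pos R 'I_(farity f) P.
- by apply: Pr => i /h h'; exact: lt_le_trans rr'.
- exact: IH.
exists r => // s s' h; apply: le_lt_trans (finterp_modulus _ _) _.
by apply: hd => k; apply: Pr => i ki; apply: h; exists k.
Qed.

Lemma eval_terms_uniform k (a : 'I_k -> term L) (e : R) : 0 < e ->
  exists2 d, 0 < d & forall s s' : nat -> M,
    (forall j i, term_var (a j) i -> mdist (s i) (s' i) < d) ->
    forall j, mdist (eval_term M s (a j)) (eval_term M s' (a j)) < e.
Proof.
move=> e0; pose P j d := forall s s' : nat -> M,
  (forall i, term_var (a j) i -> mdist (s i) (s' i) < d) ->
  mdist (eval_term M s (a j)) (eval_term M s' (a j)) < e.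
have [j r r' _ rr' Pr s s' h|j|r r0 Pr] := @uniform_pos R 'I_k P.
- by apply: Pr => i /h h'; exact: lt_le_trans rr'.
- exact: eval_term_uniform.
by exists r => // s s' h j; apply: Pr => i; exact: h.
Qed.

(** The moduli of the language handle relations and terms, compactness handles connectives, and a
    supremum or infimum inherits an estimate that is uniform in the quantified variable. *)
Lemma eval_uniform (phi : formula L) (e : R) : 0 < e ->
  exists2 d, 0 < d & forall s s' : nat -> M,
    (forall i, free_var phi i -> mdist (s i) (s' i) < d) ->
    `|eval M s phi - eval M s' phi| <= e.
Proof.
have bnd psi (s : nat -> M) i : exists B : R, forall x, `|eval M (update s i x) psi| <= B.
  by have [B hB] := eval_bounded psi; exists B.
have update_close (s s' : nat -> M) psi (j : nat) d x : 0 < d ->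
    (forall i, i <> j /\ free_var psi i -> mdist (s i) (s' i) < d) ->
    forall i, free_var psi i -> mdist (update s j x i) (update s' j x i) < d.
  by move=> d0 h i fi; rewrite /update; case: eqP => [_|ij]; [rewrite mdistxx|exact: h].
elim: phi e => [r a|t t'|k u cu a IH|j psi IH|j psi IH] e e0 /=.
- have [d d0 hd] := modulus_sum_dist_small (rmodulus r) (rarity r) e0.
  have [d' d'0 hd'] := eval_terms_uniform a d0.
  exists d' => // s s' h; apply: le_trans (rinterp_modulus _ _) (ltW (hd _ _ _)).
  by apply: hd' => k i ki; apply: h; exists k.
- have e20 : 0 < e / 2 by rewrite divr_gt0.
  have [d d0 hd] := eval_term_uniform t e20.
  have [d' d'0 hd'] := eval_term_uniform t' e20.
  exists (Num.min d d'); first by rewrite lt_min d0.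
  move=> s s' h.
  have h1 : mdist (eval_term M s t) (eval_term M s' t) < e / 2.
    by apply: hd => i ti; have := h i (or_introl ti); rewrite lt_min => /andP[].
  have h2 : mdist (eval_term M s t') (eval_term M s' t') < e / 2.
    by apply: hd' => i ti; have := h i (or_intror ti); rewrite lt_min => /andP[].
  have := metric_triangle (eval_term M s t) (eval_term M s' t) (eval_term M s t').
  have := metric_triangle (eval_term M s' t) (eval_term M s' t') (eval_term M s t').
  have := metric_triangle (eval_term M s' t) (eval_term M s t) (eval_term M s' t').
  have := metric_triangle (eval_term M s t) (eval_term M s t') (eval_term M s' t').
  rewrite (metric_sym (eval_term M s' t) (eval_term M s t)).
  rewrite (metric_sym (eval_term M s' t') (eval_term M s t')).
  move=> *; rewrite ler_norml; apply/andP; split; lra.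
- have /choice[B hB] j : exists B, forall s, `|eval M s (a j)| <= B.
    by have [B hB] := eval_bounded (a j); exists B.
  (* Uniform continuity of the connective is obtained on this compact box, which contains all values
     of the subformulas. *)
  pose K := [set v : 'rV[R]_k | forall j, `[- B j, B j]%classic (v ord0 j)].
  have cK : compact K.
    by apply: (@rV_compact _ _ (fun j => `[- B j, B j]%classic)) => j; exact: segment_compact.
  have [d d0 hd] := compact_uniform_continuity cu cK e0.
  pose P j r := forall s s' : nat -> M,
    (forall i, free_var (a j) i -> mdist (s i) (s' i) < r) ->
    `|eval M s (a j) - eval M s' (a j)| <= d / 2.
  have [j r r' _ rr' Pr s s' h|j|r r0 Pr] := @uniform_pos R 'I_k P.
  + by apply: Pr => i /h h'; exact: lt_le_trans rr'.
  + by apply: IH; rewrite divr_gt0.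
  exists r => // s s' h; apply: hd => [j|j]; rewrite !mxE.
    by rewrite /= in_itv/= -ler_norml.
  apply: (@le_lt_trans _ _ (d / 2)); last by rewrite ltr_pdivrMr// ltr_pMr// ltr1n.
  by apply: Pr => i ji; apply: h; exists j.
- have [d d0 hd] := IH _ e0; exists d => // s s' h.
  apply: sup_dist_le => [|||x]; first exact: point.
  + have [B hB] := bnd psi s j; exists B => _ [x _ <-].
    by apply: le_trans (hB x); exact: ler_norm.
  + have [B hB] := bnd psi s' j; exists B => _ [x _ <-].
    by apply: le_trans (hB x); exact: ler_norm.
  + by apply: hd; exact: update_close.
- have [d d0 hd] := IH _ e0; exists d => // s s' h.
  apply: inf_dist_le => [|||x]; first exact: point.
  + have [B hB] := bnd psi s j; exists (- B) => _ [x _ <-].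
    by have := hB x; rewrite ler_norml => /andP[].
  + have [B hB] := bnd psi s' j; exists (- B) => _ [x _ <-].
    by have := hB x; rewrite ler_norml => /andP[].
  + by apply: hd; exact: update_close.
Qed.

End uniform_continuity.

(** * Quantifier elimination *)

Section theory_of_structure.
Context {R : realType} {L : language R} (M : structure L).
Local Notation T := (Th M).
Implicit Types (phi psi : formula L) (N : structure L).

Lemma is_model_Th : is_model T M. Proof. by move=> phi []. Qed.

(** Once [k] bounds the free variables, this is a sentence whose value is the supremum of [phi],
    hence the same in all models of a complete theory. *)
Definition universal_closure k phi : formula L := iteri k (fun i psi => Sup i psi) phi.

Lemma free_var_universal_closure k phi i :
  free_var (universal_closure k phi) i -> free_var phi i /\ (k <= i)%N.
Proof.
elim: k => //= k IH [ik /IH[fi ki]]; split=> //.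
by rewrite ltn_neqAle ki andbT eq_sym; apply/eqP.
Qed.

Lemma update_id (A : Type) (s : nat -> A) i : update s i (s i) = s.
Proof. by apply/funext => j; rewrite /update; case: eqP => [->|]. Qed.

Lemma le_eval_universal_closure N (s : nat -> N) k phi :
  eval N s phi <= eval N s (universal_closure k phi).
Proof.
elim: k => //= k /le_trans; apply; apply: ub_le_sup.
  have [B hB] := eval_bounded (universal_closure k phi).
  by exists B => _ [x _ <-]; apply: le_trans (ler_norm _) (hB _ _).
by exists (s k) => //; rewrite update_id.
Qed.

Lemma eval_universal_closure_le N k phi (c : R) :
  (forall s : nat -> N, eval N s phi <= c) ->
  forall s, eval N s (universal_closure k phi) <= c.
Proof.
move=> h; elim: k => //= k IH s; apply: ge_sup; last by move=> _ [x _ <-].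
by exists (eval N (update s k point) (universal_closure k phi)), point.
Qed.

(** The bound is one on the sentence [universal_closure k phi], whose value all models share. As
    [seminorm] ranges over all models, this is what allows norms to be estimated in [M] alone. *)
Lemma Th_eval_le phi (c : R) : (forall s : nat -> M, eval M s phi <= c) ->
  forall N, is_model T N -> forall s : nat -> N, eval N s phi <= c.
Proof.
move=> h N hN s; have [k hk] := free_var_bound phi.
have sk : sentence (universal_closure k phi).
  by move=> i /free_var_universal_closure[/hk ik ki]; move: ik; rewrite ltnNge ki.
apply: le_trans (le_eval_universal_closure s k phi) _.
by rewrite (Th_value s (fun=> point : M) hN sk); exact: eval_universal_closure_le.
Qed.

Lemma of_formula_dist_le phi psi (e : R) :
  (forall s : nat -> M, `|eval M s phi - eval M s psi| <= e) ->
  `|of_formula T phi - of_formula T psi| <= e.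
Proof.
move=> h; apply: pnorm_le => N hN s; rewrite interpB// !interp_of_formula//.
rewrite ler_norml lerNl opprB -!eval_sub; apply/andP; split; apply: Th_eval_le hN s => s.
  by rewrite eval_sub; apply: le_trans (h s); rewrite distrC ler_norm.
by rewrite eval_sub; apply: le_trans (h s); rewrite ler_norm.
Qed.

Lemma of_formula_eq phi psi : (forall s : nat -> M, eval M s phi = eval M s psi) ->
  of_formula T phi = of_formula T psi.
Proof.
move=> h; apply/eqP; rewrite -subr_eq0 -normr_le0.
by apply: of_formula_dist_le => s; rewrite h subrr normr0.
Qed.

End theory_of_structure.

Arguments is_model_Th {R L} M.

Definition finitely_homogeneous (R : realType) (L : language R) (M : structure L) :=
  forall k, exists m (V : 'I_m -> formula L),
    [/\ forall j, quantifier_free (V j),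
        forall j i, free_var (V j) i -> (i < k)%N &
        forall e : R, 0 < e -> exists2 d, 0 < d & forall s s' : nat -> M,
          (forall j, `|eval M s (V j) - eval M s' (V j)| < d) ->
          exists2 g, automorphism g & forall i, (i < k)%N -> mdist (g (s i)) (s' i) < e].

Section quantifier_elimination.
Context {R : realType} {L : language R} (M : structure L).
Hypothesis hM : finitely_homogeneous M.
Local Notation T := (Th M).

(** An automorphism brings [s] close to [s'] on the free variables; it preserves the value of [phi],
    and uniform continuity bounds what remains. *)
Lemma finitely_homogeneous_uniform phi k (e : R) : 0 < e ->
  (forall i, free_var phi i -> (i < k)%N) ->
  exists m (V : 'I_m -> formula L), (forall j, quantifier_free (V j)) /\
    exists2 d, 0 < d & forall s s' : nat -> M,
      (forall j, `|eval M s (V j) - eval M s' (V j)| < d) ->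
      `|eval M s phi - eval M s' phi| <= e.
Proof.
move=> e0 hk; have [m [V [qV _ VM]]] := hM k; exists m, V; split=> //.
have [d d0 hd] := eval_uniform M phi e0; have [d' d'0 hd'] := VM _ d0.
exists d' => // s s' /hd'[g ag gs]; rewrite -(eval_automorphism s _ ag).
by apply: hd => i /hk; exact: gs.
Qed.

(* The values of phi are a function of the values of the V_j up to a uniform
   error, and the McShane formula [inf_s (phi(s) + K |v - V(s)|)] extends such a
   function to a Lipschitz function of all v. *)
Lemma quantifier_free_approximation phi (e : R) : 0 < e ->
  exists2 psi, quantifier_free psi &
    forall s : nat -> M, `|eval M s phi - eval M s psi| <= e.
Proof.
move=> e0; have [k hk] := free_var_bound phi.
have [m [V [qV [d d0 hd]]]] := finitely_homogeneous_uniform e0 hk.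
have [B0 hB0] := eval_bounded phi; pose B := `|B0| + 1.
have B_gt0 : 0 < B by rewrite ltr_wpDl.
have hB (s : nat -> M) : - B <= eval M s phi <= B.
  rewrite -ler_norml (le_trans (hB0 M s))// (le_trans (ler_norm _))//.
  by rewrite lerDl.
(* With this slope the penalty reaches [2 * B], a bound on the variation of [phi], as soon as some
   [V j] differs by [d]. *)
pose K := 2 * B / d; have K0 : 0 < K by rewrite divr_gt0// mulr_gt0.
pose W (s : nat -> M) : 'rV[R]_m := \row_j eval M s (V j).
pose u v := inf (range (fun s => eval M s phi + K * `|v - W s|)).
have lbu v : has_lbound (range (fun s => eval M s phi + K * `|v - W s|)).
  exists (- B) => _ [s _ <-]; have /andP[h _] := hB s; apply: le_trans h _.
  by rewrite lerDl mulr_ge0// ltW.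
have cu : continuous u.
  apply: (@lipschitz_continuous _ _ _ K) => // v w.
  apply: inf_dist_le => // [|s]; first exact: (fun=> point).
  rewrite opprD addrACA subrr add0r -mulrBr normrM gtr0_norm// ler_wpM2l ?(ltW K0)//.
  apply: le_trans (ler_dist_dist _ _) _.
  by rewrite opprB addrA subrK.
exists (Conn cu V) => // s /=; rewrite -/(W s).
have h1 : u (W s) <= eval M s phi.
  by apply: ge_inf => //; exists s => //; rewrite subrr normr0 mulr0 addr0.
have h2 : eval M s phi - e <= u (W s).
  apply: lb_le_inf; first by exists (eval M s phi + K * `|W s - W s|), s.
  move=> _ [s' _ <-].
  have K_ge0 := ltW K0; have n_ge0 := normr_ge0 (W s - W s').
  (* Assignments [s'] close to [s] for all [V j] are handled by the choice of [d], the others by the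
     penalty. *)
  have [h|] := pselect (forall j, `|eval M s (V j) - eval M s' (V j)| < d).
    have := hd _ _ h; rewrite ler_norml => /andP[_].
    by have := mulr_ge0 K_ge0 n_ge0; lra.
  move=> /existsNP[j /negP]; rewrite -leNgt => dj.
  have : d <= `|W s - W s'|.
    by apply: le_trans dj _; have := mx_norm_ge_coord (W s - W s') j; rewrite !mxE.
  move=> /(ler_wpM2l K_ge0); rewrite divfK ?gt_eqF//.
  by have := hB s; have := hB s'; move=> /andP[? ?] /andP[? ?]; lra.
by rewrite ger0_norm; lra.
Qed.

Lemma finitely_homogeneous_eliminates_quantifiers : eliminates_quantifiers T.
Proof.
move=> O [p Op] oO; have /nbhs_ballP[e /= e0 eO] : nbhs p O by exact: open_nbhs_nbhs.
have e30 : 0 < e / 3 by rewrite divr_gt0.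
have [phi hphi] := of_formula_dense p e30.
have [psi qpsi hpsi] := quantifier_free_approximation phi e30.
exists (of_formula T psi); split; last by exists psi.
apply: eO; rewrite -ball_normE /=.
have := of_formula_dist_le hpsi => h.
rewrite -(subrKA (of_formula T phi)).
apply: le_lt_trans (ler_normD _ _) _; move: hphi h; lra.
Qed.

End quantifier_elimination.

(** * Types *)

Section types_of_structure.
Context {R : realType} {L : language R} (M : structure L) (n : option nat).
Local Notation T := (Th M).
Local Notation P := (predicates T n).
Implicit Types (phi psi : formula L) (p q : P).

Let modelM : is_model T M. Proof. exact: is_model_Th. Qed.

Lemma in_predicates_of_formula phi :
  formulas_in n phi -> in_predicates (T := T) n (of_formula T phi).
Proof. by move=> h; apply/asboolP; apply: subset_closure; exists phi. Qed.

Definition formula_predicate phi (h : formulas_in n phi) : P :=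
  exist _ (of_formula T phi) (in_predicates_of_formula h).

Lemma formula_predicate_dense p (e : R) : 0 < e ->
  exists phi (h : formulas_in n phi), `|p - formula_predicate h| < e.
Proof.
move=> e0; have /asboolP pin := valP p.
have [_ [[phi hphi <-]]] := pin _ (nbhsx_ballx (val p) e e0).
by rewrite -ball_normE/= => h; exists phi, hphi.
Qed.

Lemma tp_ntype (a : power M n) : is_ntype (tp (T := T) a).
Proof.
have tpZD : scalar (tp (T := T) a).
  by move=> c p q; rewrite /tp linearP interpD// interpZ.
have tp_le p : `|tp (T := T) a p| <= `|p| by exact: interp_le_pnorm.
split=> //.
- by move=> p q; rewrite /tp rmorphM interpM.
- by exists 1; rewrite /tp rmorph1 interp_of_formula//= => /eqP; rewrite oner_eq0.
move=> p; apply/(@cvgrPdist_lt _ _ _ (nbhs p)) => e e0; apply/nbhs_ballP; exists e => //= q.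
rewrite -ball_normE/=; apply: le_lt_trans.
by rewrite -mulN1r addrC -tpZD scaleN1r addrC.
Qed.

Section ntype.
Variable x : P -> R.
Hypothesis hx : is_ntype x.

Lemma ntype0 : x 0 = 0.
Proof.
by case: hx => xZD *; have := xZD (-1) 0 0; rewrite scaler0 addr0 mulN1r addNr.
Qed.

Lemma ntypeD p q : x (p + q) = x p + x q.
Proof. by case: hx => xZD *; rewrite -[p]scale1r xZD mul1r scale1r. Qed.

Lemma ntypeZ c p : x (c *: p) = c * x p.
Proof. by case: hx => xZD *; rewrite -[c *: p]addr0 xZD ntype0 addr0. Qed.

Lemma ntypeB p q : x (p - q) = x p - x q.
Proof. by rewrite ntypeD -scaleN1r ntypeZ mulN1r. Qed.

Lemma ntype1 : x 1 = 1.
Proof.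
case: hx => _ xM [p /eqP xp] _ _; apply: (mulfI xp).
by rewrite -xM !mulr1.
Qed.

Lemma ntype_dist_le p q : `|x p - x q| <= `|p - q|.
Proof. by rewrite -ntypeB; case: hx. Qed.

(* If the phi_j never came within e of the values x(phi_j) simultaneously, then
   [sum_j (phi_j - x(phi_j))^2] would be invertible although x annihilates it. *)
Lemma ntype_approximation m (phi : 'I_m -> formula L)
    (h : forall j, formulas_in n (phi j)) (e : R) : 0 < e ->
  exists s : nat -> M,
    forall j, `|eval M s (phi j) - x (formula_predicate (h j))| < e.
Proof.
move=> e0; apply: contrapT => /forallNP far.
have [_ xM [p xp] _ _] := hx; apply: xp.
pose c j := x (formula_predicate (h j)).
pose u (v : 'rV[R]_m) : R := \sum_j (v ord0 j - c j) * (v ord0 j - c j).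
have cu : continuous u.
  apply: continuous_big; first exact: add_continuous.
  have cj j : continuous (fun v : 'rV[R]_m => v ord0 j - c j).
    by move=> v; exact: cvgB (@coord_continuous R 1 m ord0 j v) (cvg_cst _).
  by move=> j _ v; exact: cvgM (cj j v) (cj j v).
have e20 : 0 < e ^+ 2 by rewrite exprn_gt0.
(* The maximum with [e ^+ 2] makes the reciprocal a continuous connective on the whole space. By
   [far], [u] is at least [e ^+ 2] on the values taken in [M], where [w] is thus its inverse. *)
pose w (v : 'rV[R]_m) : R := (Num.max (e ^+ 2) (u v))^-1.
have cw : continuous w.
  have cmax : continuous (fun v => Num.max (e ^+ 2) (u v)).
    exact: (@max_fun_continuous _ _ R _ u (@cst_continuous _ _ (e ^+ 2)) cu).
  move=> v; have nz : Num.max (e ^+ 2) (u v) != 0 by rewrite gt_eqF// lt_max e20.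
  exact: cvgV nz (cmax v).
have inu : formulas_in n (Conn cu phi) by move=> i [j] /h.
have inw : formulas_in n (Conn cw phi) by move=> i [j] /h.
have uw : formula_predicate inu * formula_predicate inw = 1.
  apply: val_inj; rewrite rmorphM rmorph1 /=.
  transitivity (of_formula T (fmul (Conn cu phi) (Conn cw phi))).
    by apply: interp_inj => N hN s; rewrite interpM// !interp_of_formula// eval_mul.
  apply: of_formula_eq => s; rewrite eval_mul eval_cst /= /w.
  have /existsNP[j /negP] := far s; rewrite -leNgt => ej.
  have eu : e ^+ 2 <= u (\row_j eval M s (phi j)).
    rewrite /u (bigD1 j)//= mxE -[X in X <= _]addr0 lerD//.
      by rewrite -expr2 -[_ ^+ 2 in leRHS]real_normK ?num_real// ler_sqr ?nnegrE// ltW.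
    by apply: sumr_ge0 => i _; rewrite -expr2 sqr_ge0.
  by rewrite max_r// mulfV// gt_eqF// (lt_le_trans e20).
(* [x] is multiplicative and sends each [y j] to 0, so it kills the sum of their squares. *)
have xu : x (formula_predicate inu) = 0.
  pose y j := formula_predicate (h j) - c j *: 1.
  rewrite (_ : formula_predicate inu = \sum_j y j * y j).
    rewrite (big_morph x ntypeD ntype0) big1// => j _.
    by rewrite xM ntypeB ntypeZ ntype1 mulr1 subrr mul0r.
  apply: val_inj; rewrite raddf_sum /=; apply: interp_inj => N hN s.
  rewrite interp_of_formula//= /u.
  rewrite (big_morph (interp s) (fun f g => interpD s f g hN) (interp0 s hN)).
  apply: eq_bigr => j _.
  by rewrite interpM// interpB// interpZ// !interp_of_formula//= mulr1 mxE.
by rewrite -[p]mul1r -uw !xM xu !mul0r.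
Qed.

End ntype.
End types_of_structure.

(** * Powers and orbit closures *)

Lemma expr2V_small (R : realType) (e : R) : 0 < e ->
  exists N, forall k, (N <= k)%N -> 2 ^- k < e.
Proof.
move=> e0; have [N _ hN] := near_infty_natSinv_expn_lt (PosNum e0).
by exists N => k /hN; rewrite /= div1r.
Qed.

Lemma double_expr2VS (R : realType) k : 2 ^- k.+1 + 2 ^- k.+1 = 2 ^- k :> R.
Proof. by rewrite exprS invfM -mulr2n -mulrnAl -mulr_natr mulVf ?mul1r// pnatr_eq0. Qed.

Section power_metric.
Context {R : realType} {L : language R} (M : structure L).
Implicit Types (n : option nat).

Lemma weighted_dist_ge0 (x y : nat -> M) i : 0 <= weighted_dist x y i.
Proof. by rewrite mulr_ge0 ?invr_ge0 ?exprn_ge0// le_min ler01 mdist_ge0. Qed.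

Lemma weighted_dist_le_expr (x y : nat -> M) i : weighted_dist x y i <= 2 ^- i.
Proof. by rewrite ler_piMr ?invr_ge0 ?exprn_ge0// ge_min lexx. Qed.

Lemma weighted_dist_le_mdist (x y : nat -> M) i : weighted_dist x y i <= mdist (x i) (y i).
Proof.
apply: (@le_trans _ _ (Num.min 1 (mdist (x i) (y i)))); last by rewrite ge_min lexx orbT.
rewrite ler_piMl// ?le_min ?ler01 ?mdist_ge0// invf_le1 ?exprn_gt0//.
by rewrite exprn_ege1// ler1n.
Qed.

(** Each new term is at most [2 ^- (k + N)], exactly the drop of [2 * 2 ^- (k + N)] when [N] grows
    by one; keeping this tail on the left makes the induction close. *)
Lemma series_weighted_dist_le (x y : nat -> M) k (d : R) N : 0 <= d ->
  (forall i, (i < k)%N -> mdist (x i) (y i) <= d) ->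
  series (weighted_dist x y) (k + N)%N + 2 * 2 ^- (k + N)%N <= k%:R * d + 2 * 2 ^- k.
Proof.
move=> d0 xy; elim: N => [|N IH].
  rewrite addn0 lerD2r /series /= -[X in X%:R * _](subn0 k) mulr_natl -sumr_const_nat.
  rewrite big_nat [leRHS]big_nat; apply: ler_sum => i /andP[_ ik].
  exact: le_trans (weighted_dist_le_mdist _ _ _) (xy _ ik).
apply: le_trans IH; rewrite addnS /series /= big_nat_recr//=.
have := weighted_dist_le_expr x y (k + N)%N; have := double_expr2VS R (k + N)%N.
by move: (2 ^- _) (2 ^- _) => a b; lra.
Qed.

Lemma series_weighted_dist_nondecreasing (x y : nat -> M) :
  nondecreasing_seq (series (weighted_dist x y)).
Proof.
apply/nondecreasing_seqP => j.
by rewrite /series/= big_nat_recr//= lerDl weighted_dist_ge0.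
Qed.

Lemma is_cvg_series_weighted_dist (x y : nat -> M) : cvgn (series (weighted_dist x y)).
Proof.
apply: nondecreasing_is_cvgn; first exact: series_weighted_dist_nondecreasing.
exists 2 => _ [N _ <-].
have h i : (i < 0)%N -> mdist (x i) (y i) <= 0 by [].
have := series_weighted_dist_le N (lexx _) h.
rewrite mul0r add0r expr0 invr1 mulr1 add0n; apply: le_trans.
by rewrite lerDl mulr_ge0// invr_ge0 exprn_ge0.
Qed.

Lemma weighted_dist_le_limn (x y : nat -> M) i :
  weighted_dist x y i <= limn (series (weighted_dist x y)).
Proof.
apply: (@le_trans _ _ (series (weighted_dist x y) i.+1)).
  rewrite /series/= big_nat_recr//= lerDr sumr_ge0// => j _.
  exact: weighted_dist_ge0.
apply: nondecreasing_cvgn_le; first exact: series_weighted_dist_nondecreasing.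
exact: is_cvg_series_weighted_dist.
Qed.

Lemma pad_ord k (a : power M (Some k)) (i : 'I_k) : pad a i = a i.
Proof. by rewrite /pad valK. Qed.

Lemma pad_close n i (e : R) : in_index n i -> 0 < e ->
  exists2 d, 0 < d & forall a b : power M n, mdist a b < d ->
    mdist (pad a i) (pad b i) < e.
Proof.
case: n => [k|] ik e0.
  exists e => // a b; apply: le_lt_trans; rewrite !(pad_ord _ (Ordinal ik)).
  rewrite [leRHS](_ : _ = sum_dist a b)// /sum_dist (bigD1 (Ordinal ik))//= lerDl.
  by apply: sumr_ge0 => j _; exact: mdist_ge0.
have w0 : 0 < 2 ^- i :> R by rewrite invr_gt0 exprn_gt0.
(* The factor [2 ^- i] undoes the weight; the minimum with 1 accounts for the truncation of the
   metric at 1. *)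
exists (2 ^- i * Num.min 1 e); first by rewrite mulr_gt0// lt_min ltr01.
move=> a b /(le_lt_trans (weighted_dist_le_limn a b i)).
by rewrite /weighted_dist ltr_pM2l// lt_min !gt_min ltxx/= ltNge; lra.
Qed.

(** In the infinite power the weights from [k] on sum to [2 * 2 ^- k], so finitely many coordinates
    control the distance. *)
Lemma power_close n (e : R) : 0 < e ->
  exists k d, [/\ 0 < d, forall i, (i < k)%N -> in_index n i &
    forall a b : power M n, (forall i, (i < k)%N -> mdist (pad a i) (pad b i) < d) ->
      mdist a b < e].
Proof.
move=> e0; case: n => [k|].
  have [d d0 hd] := sum_dist_small M k e0; exists k, d; split=> // a b ab.
  by apply: hd => i; rewrite -!pad_ord; exact: ab.
have e40 : 0 < e / 4 by rewrite divr_gt0.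
have [k hk] := expr2V_small e40.
have k0 : 0 < k%:R + 1 :> R by rewrite ltr_wpDl.
(* The first [k] coordinates then contribute at most [e / 4] and the others at most [e / 2]; adding
   1 to [k] avoids a division by 0. *)
pose d := e / 4 / (k%:R + 1); have d0 : 0 < d by rewrite divr_gt0.
exists k, d; split=> // a b ab.
have kd : k%:R * d <= e / 4.
  by rewrite mulrC -mulrA ger_pMr// mulrC ler_pdivrMr// mul1r lerDl.
suff : limn (series (weighted_dist a b)) <= e / 4 + 2 * (e / 4).
  by move=> /le_lt_trans; apply; lra.
apply: limr_le; first exact: is_cvg_series_weighted_dist.
exists k => // N /= kN; rewrite -(subnKC kN).
have := @series_weighted_dist_le a b k d (N - k)%N (ltW d0) (fun i ik => ltW (ab i ik)).
have : 0 <= 2 * 2 ^- (k + (N - k))%N :> R by rewrite mulr_ge0// invr_ge0 exprn_ge0.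
by have := hk k (leqnn k); lra.
Qed.

Lemma closureP n (A : set (power M n)) b : closure A b <->
  forall e : R, 0 < e -> exists2 a, A a & mdist b a < e.
Proof.
split=> [Ab e e0|h B /nbhs_ballP[e /= e0 eB]].
  have [a [Aa]] := Ab _ (nbhsx_ballx b e e0).
  by rewrite ballEmdist; exists a.
by have [a Aa ba] := h _ e0; exists a; split=> //; apply: eB; rewrite ballEmdist.
Qed.

End power_metric.

(** The tail is kept on the left as in [series_weighted_dist_le]. The threshold [k] is there
    because, in the infinite power, a coordinate is controlled only from some stage on. *)
Lemma geometric_cvgn (R : realType) (M : completeMetricType R) (u : nat -> M) k :
  (forall j, (k <= j)%N -> mdist (u j) (u j.+1) < 2 ^- j) -> cvgn u.
Proof.
move=> h.
have tail j l : (k <= j)%N -> mdist (u j) (u (j + l)%N) + 2 * 2 ^- (j + l)%N <= 2 * 2 ^- j.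
  move=> kj; elim: l => [|l IH]; first by rewrite addn0 mdistxx add0r.
  have := h (j + l)%N (leq_trans kj (leq_addr _ _)).
  have := metric_triangle (u j) (u (j + l)%N) (u (j + l.+1)%N).
  rewrite addnS; have := double_expr2VS R (j + l)%N.
  by move: IH; move: (2 ^- _) (2 ^- _) (2 ^- _) => a b c; lra.
apply/cauchy_cvgP/cauchy_exP => e e0; have [N hN] := expr2V_small (divr_gt0 e0 (ltr0Sn R 1)).
exists (u (maxn N k)); exists (maxn N k) => // j /= Nj; rewrite ballEmdist /=.
rewrite -(subnKC Nj); have := tail _ (j - maxn N k)%N (leq_maxr N k).
have := hN _ (leq_maxl N k).
have : 0 <= 2 * 2 ^- (maxn N k + (j - maxn N k))%N :> R.
  by rewrite mulr_ge0// invr_ge0 exprn_ge0.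
by lra.
Qed.

(** * Types and orbit closures *)

Section types_and_orbits.
Context {R : realType} {L : language R} (M : structure L) (n : option nat).
Local Notation T := (Th M).
Local Notation P := (predicates T n).
Local Notation point_type a := (tp (T := T) (a : power M n)).

Lemma tp_formula_predicate phi (h : formulas_in n phi) (a : power M n) :
  point_type a (formula_predicate M h) = eval M (pad a) phi.
Proof. exact/interp_of_formula/is_model_Th. Qed.

Lemma pad_comp (g : M -> M) (a : power M n) i :
  in_index n i -> pad (g \o a : power M n) i = g (pad a i).
Proof.
case: n a => [k|] a ni //.
by rewrite !(pad_ord _ (Ordinal ni)).
Qed.

Lemma tp_automorphism (g : M -> M) (a : power M n) :
  automorphism g -> point_type (g \o a) = point_type a.
Proof.
move=> ag; apply/funext => p; rewrite /tp.
transitivity (interp (g \o pad a) (val p)).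
  apply: (interp_in p (is_model_Th M)) => i.
  exact: pad_comp.
by rewrite /interp; congr (limn _); apply/funext => i; exact: eval_automorphism.
Qed.

(** [p] is within [e / 3] of a formula, which depends uniformly on its finitely many free
    coordinates. *)
Lemma tp_uniform (p : P) (e : R) : 0 < e ->
  exists2 d, 0 < d & forall a b : power M n, mdist a b < d ->
    `|point_type a p - point_type b p| <= e.
Proof.
move=> e0; have e30 : 0 < e / 3 by rewrite divr_gt0.
have [phi [h hp]] := formula_predicate_dense p e30.
have [d d0 hd] := eval_uniform M phi e30.
have [k hk] := free_var_bound phi.
pose Q (i : 'I_k) r := in_index n i -> forall a b : power M n, mdist a b < r ->
  mdist (pad a i) (pad b i) < d.
have [i r r' _ rr' Qr ni a b ab|i|r r0 Qr] := @uniform_pos R 'I_k Q.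
- by apply: Qr => //; exact: lt_le_trans rr'.
- have [ni|] := pselect (in_index n i); last by exists 1.
  by have [r r0 hr] := pad_close M ni d0; exists r => // _.
exists r => // a b ab.
have : `|eval M (pad a) phi - eval M (pad b) phi| <= e / 3.
  by apply: hd => i fi; exact: (Qr (Ordinal (hk _ fi)) (h _ fi)).
have := ntype_dist_le (tp_ntype a) p (formula_predicate M h).
have := ntype_dist_le (tp_ntype b) p (formula_predicate M h).
rewrite !tp_formula_predicate; move: hp; move: `|p - _| => c hp.
rewrite !ler_norml => /andP[? ?] /andP[? ?] /andP[? ?].
by apply/andP; split; lra.
Qed.

Lemma aut_orbit_refl (a : power M n) : aut_orbit a a.
Proof. by exists id => //; exact: automorphism_id. Qed.

(** Types are invariant under automorphisms and uniformly continuous in the tuple, hence constant on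
    orbit closures: the map of the theorem is well defined. *)
Lemma tp_closure_orbit (a b : power M n) :
  closure (aut_orbit a) b -> point_type b = point_type a.
Proof.
move=> ab; apply/funext => p; apply/eqP; rewrite -subr_eq0 -normr_le0.
apply/ler_addgt0Pl => e e0; rewrite addr0.
have [d d0 hd] := tp_uniform p e0.
have [_ [g ag ->] bg] := (closureP (aut_orbit a) b).1 ab d d0.
by rewrite -(tp_automorphism a ag); exact: hd.
Qed.

Lemma mdist_automorphism (g : M -> M) (a b : power M n) :
  automorphism g -> mdist (g \o a : power M n) (g \o b : power M n) = mdist a b.
Proof.
move=> [_ dg _ _]; case: n a b => [k|] a b.
  by apply: eq_bigr => i _; rewrite /= dg.
by congr (limn (series _)); apply/funext => i; rewrite /weighted_dist /= dg.
Qed.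

(** Automorphisms act by isometries on powers: if [g] moves [b] near [c], it moves a translate of
    [a] near [b] to one near [c]. Hence two tuples, each in the orbit closure of the other, have
    equal orbit closures. *)
Lemma closure_orbit_sub (a b : power M n) : closure (aut_orbit a) b ->
  closure (aut_orbit b) `<=` closure (aut_orbit a).
Proof.
move=> /closureP ab c /closureP bc; apply/closureP => e e0.
have e20 : 0 < e / 2 by rewrite divr_gt0.
have [_ [g ag ->] cg] := bc _ e20; have [_ [h ah ->] bh] := ab _ e20.
exists (g \o (h \o a)); first by exists (g \o h) => //; exact: automorphism_comp.
apply: (le_lt_trans (metric_triangle _ (g \o b : power M n) _)).
by rewrite (splitr e) ltrD// mdist_automorphism.
Qed.

(** Number of coordinates controlled at stage [j]: all of them in a finite power, the first [j] in
    the infinite one, so that each coordinate is controlled from some stage on. *)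
Definition level j := if n is Some m then m else j.

Lemma level_index j i : (i < level j)%N -> in_index n i.
Proof. by rewrite /level; case: n. Qed.

Lemma index_level i : in_index n i -> exists j0, forall j, (j0 <= j)%N -> (i < level j)%N.
Proof. by rewrite /level; case: n => [m|] /= h; [exists 0%N|exists i.+1]. Qed.

Lemma formula_predicate_irrelevance phi psi (h : formulas_in n phi) (h' : formulas_in n psi) :
  phi = psi -> formula_predicate M h = formula_predicate M h'.
Proof. by move=> e; apply: val_inj => /=; rewrite e. Qed.

(** The two families are concatenated and approximated together with the smaller tolerance. This
    lets an approximation of one stage also meet further constraints. *)
Lemma ntype_approximation2 (x : P -> R) (hx : is_ntype x) m1 m2
    (V1 : 'I_m1 -> formula L) (V2 : 'I_m2 -> formula L)
    (h1 : forall j, formulas_in n (V1 j)) (h2 : forall j, formulas_in n (V2 j))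
    (e1 e2 : R) : 0 < e1 -> 0 < e2 ->
  exists s : nat -> M,
    (forall j, `|eval M s (V1 j) - x (formula_predicate M (h1 j))| < e1) /\
    (forall j, `|eval M s (V2 j) - x (formula_predicate M (h2 j))| < e2).
Proof.
move=> e10 e20.
pose V (j : 'I_(m1 + m2)) := match fintype.split j with inl i => V1 i | inr i => V2 i end.
have h j : formulas_in n (V j) by rewrite /V; case: fintype.split.
have e0 : 0 < Num.min e1 e2 by rewrite lt_min e10.
have [s hs] := ntype_approximation hx h e0; exists s; split=> j.
  have := hs (lshift m2 j).
  rewrite (@formula_predicate_irrelevance _ (V1 j) _ (h1 j)) /V (unsplitK (inl j))//.
  by rewrite lt_min => /andP[].
have := hs (rshift m1 j).
rewrite (@formula_predicate_irrelevance _ (V2 j) _ (h2 j)) /V (unsplitK (inr j))//.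
by rewrite lt_min => /andP[].
Qed.

Hypothesis hM : finitely_homogeneous M.

(** Equal types give equal values to the formulas that decide homogeneity, so at every precision
    some automorphism carries [a] near [b]. *)
Lemma tp_eq_closure_orbit (a b : power M n) :
  point_type a = point_type b -> closure (aut_orbit a) b.
Proof.
move=> ab; apply/closureP => e e0.
have [k [d [d0 hk hd]]] := power_close M n e0.
have [m [V [_ fV VM]]] := hM k; have [r r0 hr] := VM _ d0.
have [j|g ag hg] := hr (pad a) (pad b).
  have hj : formulas_in n (V j) by move=> i /fV/hk.
  have := congr1 (fun f : P -> R => f (formula_predicate M hj)) ab.
  by rewrite !tp_formula_predicate => ->; rewrite subrr normr0.
exists (g \o a); first by exists g.
rewrite metric_sym; apply: hd => i ik; rewrite pad_comp; [exact: hg|exact: hk].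
Qed.

(* Approximate realizations of x on more and more formulas are corrected by
   automorphisms into a Cauchy sequence; its limit realizes x exactly. *)
Lemma ntype_realized (x : P -> R) : is_ntype x -> exists a, point_type a = x.
Proof.
move=> hx.
pose near_type m (V : 'I_m -> formula L) (h : forall j, formulas_in n (V j)) (e : R) :=
  [set s : nat -> M | forall j, `|eval M s (V j) - x (formula_predicate M (h j))| < e].
(* [A j] collects the assignments nearly realizing [x] on the formulas for [level j]; any two of
   them are matched by an automorphism up to [2 ^- j]. The tolerance is [d / 2] because they are
   compared through the values of [x]. *)
have /choice[A hA] : forall j, exists A : set (nat -> M), exists m V h (e : R),
    [/\ 0 < e, A = @near_type m V h e &
      forall s s', A s -> A s' -> exists2 g, automorphism g &
        forall i, (i < level j)%N -> mdist (g (s i)) (s' i) < 2 ^- j].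
  move=> j; have [m [V [_ fV VM]]] := hM (level j).
  have p0 : 0 < 2 ^- j :> R by rewrite invr_gt0 exprn_gt0.
  have [d d0 hd] := VM _ p0.
  have h l : formulas_in n (V l) by move=> i /fV/level_index.
  exists (near_type m V h (d / 2)), m, V, h, (d / 2); split=> // [|s s' hs hs'].
    by rewrite divr_gt0.
  apply: hd => l; rewrite -(subrKA (x (formula_predicate M (h l)))).
  apply: le_lt_trans (ler_normD _ _) _; rewrite (splitr d).
  by apply: ltrD; [exact: hs|rewrite distrC; exact: hs'].
have A_automorphism j g s : automorphism g -> A j s -> A j (g \o s).
  move=> ag; have [m [V [h [e [_ -> _]]]]] := hA j.
  by move=> hs l; rewrite eval_automorphism//; exact: hs.
have A_meet j m V h e : 0 < e -> exists2 s, A j s & near_type m V h e s.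
  move=> e0; have [m' [V' [h' [e' [e'0 -> _]]]]] := hA j.
  by have [s [hs hs']] := ntype_approximation2 hx h' h e'0 e0; exists s.
(* Next term of the sequence: an assignment in both [A j] and [A j.+1] is moved close to [s] by an
   automorphism, which keeps it in [A j.+1]. *)
have /choice[f hf] : forall js : nat * (nat -> M), exists s', A js.1 js.2 ->
    A js.1.+1 s' /\ forall i, (i < level js.1)%N -> mdist (js.2 i) (s' i) < 2 ^- js.1.
  move=> [j s] /=; have [As|] := pselect (A j s); last by exists s.
  have [m [V [h [e [e0 AE _]]]]] := hA j.+1.
  have [t At At'] := A_meet j m V h e e0.
  have [m' [V' [h' [e' [_ _ hj]]]]] := hA j.
  have [g ag gts] := hj _ _ At As.
  exists (g \o t) => _; split=> [|i /gts]; last by rewrite metric_sym.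
  by apply: A_automorphism => //; rewrite AE.
have [s0 As0] : exists s, A 0%N s.
  have [m [V [h [e [e0 _ _]]]]] := hA 0%N; have [s As _] := A_meet 0%N m V h e e0.
  by exists s.
pose fix sq j := if j is j'.+1 then f (j', sq j') else s0.
have Asq j : A j (sq j) by elim: j => //= j /(hf (j, sq j))[].
have dsq j i : (i < level j)%N -> mdist (sq j i) (sq j.+1 i) < 2 ^- j.
  by have [_] := hf (j, sq j) (Asq j); exact.
have cvg_sq i : in_index n i -> cvgn (fun j => sq j i).
  move=> /index_level[j0 hj0]; apply: (@geometric_cvgn _ _ _ j0) => j /hj0.
  exact: dsq.
pose a : power M n := match n return power M n with
  | Some k => fun i : 'I_k => limn (fun j => sq j i)
  | None => fun i => limn (fun j => sq j i) end.
have pad_a i : in_index n i -> sq j i @[j --> \oo] --> pad a i.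
  move=> ni; rewrite (_ : pad a i = limn (fun j => sq j i)); first exact: cvg_sq.
  rewrite /a; move: (ni); case: n => // k ki.
  by rewrite (pad_ord _ (Ordinal ki)).
have xE phi (h : formulas_in n phi) : eval M (pad a) phi = x (formula_predicate M h).
  apply/eqP; rewrite -subr_eq0 -normr_le0; apply/ler_addgt0Pl => e e0; rewrite addr0.
  have e40 : 0 < e / 4 by rewrite divr_gt0.
  have [d d0 hd] := eval_uniform M phi e40; have [k hk] := free_var_bound phi.
  have [N hN] := expr2V_small d0.
  have near_a : \forall j \near \oo, forall i : 'I_k, in_index n i ->
      mdist (pad a i) (sq j i) < d.
    apply: filter_forall => i.
    have [ni|nni] := pselect (in_index n i); last exact: nearW.
    have /cvg_ball/(_ _ d0) := pad_a _ ni.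
    by apply: filterS => j; rewrite ballEmdist.
  have near_level : \forall j \near \oo, forall i : 'I_k, in_index n i -> (i < level j)%N.
    apply: filter_forall => i.
    have [ni|nni] := pselect (in_index n i); last exact: nearW.
    by have [j0 hj0] := index_level ni; exists j0 => // j /hj0.
  have [j [[ja jl] jN]] := filter_ex (filterI (filterI near_a near_level) (nbhs_infty_ge N)).
  (* [t] nearly realizes [x] on [phi] itself; like [sq j] it lies in [A j], so an automorphism
     brings it near [sq j], which is near the limit. Each of the three comparisons costs [e / 4]. *)
  have [t At xt] := A_meet j 1%N (fun=> phi) (fun=> h) (e / 4) e40.
  have [m' [V' [h' [e' [_ _ hj]]]]] := hA j.
  have [g ag gts] := hj _ _ At (Asq j).
  have h1 : `|eval M (pad a) phi - eval M (sq j) phi| <= e / 4.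
    by apply: hd => i fi; exact: (ja (Ordinal (hk _ fi)) (h _ fi)).
  have h2 : `|eval M t phi - eval M (sq j) phi| <= e / 4.
    rewrite -(eval_automorphism t phi ag); apply: hd => i fi.
    apply: lt_trans (gts i _) (hN _ jN).
    exact: (jl (Ordinal (hk _ fi)) (h _ fi)).
  have := xt ord0; move: h1 h2.
  move: (eval _ _ _) (eval _ _ _) (eval _ _ _) (x _) => b c u v.
  rewrite ltr_norml !ler_norml => /andP[? ?] /andP[? ?] /andP[? ?].
  by apply/andP; split; lra.
exists a; apply/funext => p; apply/eqP; rewrite -subr_eq0 -normr_le0.
apply/ler_addgt0Pl => e e0; rewrite addr0.
have [phi [h hp]] := formula_predicate_dense p (divr_gt0 e0 (ltr0Sn R 1)).
have := ntype_dist_le (tp_ntype a) p (formula_predicate M h).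
have := ntype_dist_le hx p (formula_predicate M h).
rewrite -xE tp_formula_predicate.
rewrite distrC => h1 h2; rewrite -(subrKA (eval M (pad a) phi)).
by rewrite (le_trans (ler_normD _ _))// (splitr e) lerD//;
  [apply: le_trans h2 _|apply: le_trans h1 _]; exact: ltW.
Qed.

(** [F] takes the type of a chosen representative; its inverse sends a type to the orbit closure of
    a chosen realization. *)
Lemma finitely_homogeneous_types :
  exists F : orbit_closure_space M n -> type_space T n,
    (forall a : power M n, set_val (F (orbit_closure a)) = point_type a) /\
    bijective F.
Proof.
have repr_orbit (c : orbit_closure_space M n) : exists a : power M n, c = orbit_closure a.
  by have [a _ ac] := set_valP c; exists a; apply: val_inj; rewrite /= -ac.
have [rep hrep] := choice repr_orbit.
pose F c : type_space T n := exist _ (point_type (rep c)) (mem_set (tp_ntype (rep c))).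
have orbit_eq a b : orbit_closure a = orbit_closure b -> point_type a = point_type b.
  move=> ab; have {}ab : closure (aut_orbit a) = closure (aut_orbit b) := congr1 set_val ab.
  apply: tp_closure_orbit; rewrite -ab.
  exact/subset_closure/aut_orbit_refl.
have FE a : set_val (F (orbit_closure a)) = point_type a by exact/orbit_eq/esym/hrep.
exists F; split=> //.
have realize (t : type_space T n) : exists a, point_type a = set_val t.
  exact: ntype_realized (set_valP t).
have [real hreal] := choice realize.
have F_real t : F (orbit_closure (real t)) = t.
  by apply: val_inj; exact: etrans (FE _) (hreal t).
exists (fun t => orbit_closure (real t)) => // c.
rewrite [RHS](hrep c); have ab : point_type (real (F c)) = point_type (rep c) := hreal (F c).
apply: val_inj => /=; apply/seteqP; split; apply: closure_orbit_sub.
  by apply: tp_eq_closure_orbit; rewrite ab.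
by apply: tp_eq_closure_orbit.
Qed.

End types_and_orbits.

(** * Matching colorings *)

Section color_matching.
Variables (I E : finType) (c c' : I -> E).

Let mismatch (p : {perm I}) := [set j | c (p j) != c' j]%SET.

(* A permutation with the fewest mismatches admits no improving transposition. *)
Lemma color_matching : exists p : {perm I},
  (#|[set j | c (p j) != c' j]%SET| <=
   \sum_(x : E) (#|[set j | c' j == x]%SET| - #|[set j | c j == x]%SET|))%N.
Proof.
case: (arg_minnP (fun p => #|mismatch p|) (isT : xpredT (1%g : {perm I}))) => p _ pmin.
exists p; rewrite -/(mismatch p) -sum1_card (partition_big c' predT)//=.
apply: leq_sum => x _; rewrite sum1_card.
have card_cp : #|[set j | c (p j) == x]%SET| = #|[set j | c j == x]%SET|.
  have := card_preimset [set j | c j == x]%SET (@perm_inj I p) => <-.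
  by apply: eq_card => j; rewrite !inE.
have [/pred0P/eq_card0 -> //|/pred0Pn[j0 /=]] :=
  boolP (pred0b [pred j | (j \in mismatch p) && (c' j == x)]).
rewrite inE => /andP[mj0 /eqP cj0].
(* [j0] wants color [x] and lacks it. If some [j2] had color [x] without wanting it, swapping [j0]
   and [j2] would repair [j0] and spoil nothing, against minimality. *)
have sub j2 : c (p j2) == x -> c' j2 == x.
  move=> /eqP cj2; apply/negPn/negP => cj2'.
  have := pmin (tperm j0 j2 * p)%g isT.
  rewrite leqNgt => /negP; apply; apply: proper_card; apply/properP; split.
    apply/fintype.subsetP => j; rewrite !inE permM.
    case: tpermP => [->|->|//]; first by rewrite cj2 -cj0 eqxx.
    by move=> _; rewrite cj2 eq_sym cj2'.
  by exists j0; rewrite !inE// permM tpermL cj2 cj0 eqxx.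
(* By [sub], the indices having color [x] are among those wanting it, so the difference of cardinals
   counts those that want it without having it. *)
rewrite -card_cp -cardsDS; last by apply/fintype.subsetP => j; rewrite !inE; exact: sub.
apply/subset_leq_card/fintype.subsetP => j; rewrite !inE => /andP[mj /eqP cj].
by move: mj; rewrite inE cj eqxx andbT.
Qed.

End color_matching.

(** * Measure algebras *)

Section measure_algebra_theory.
Context d (X : measurableType d) (R : realType) (mu : probability X R).
Local Notation M := (MAlg mu).
Local Notation m A := (fine (mu A)).

Lemma measurableY (A B : set X) : measurable A -> measurable B -> measurable (A `+` B).
Proof. by move=> mA mB; apply: measurableU; exact: measurableD. Qed.

Lemma fine_measure_le (A B : set X) : measurable A -> measurable B ->
  A `<=` B -> m A <= m B.
Proof.
move=> mA mB AB; rewrite -lee_fin !fineK ?fin_num_measure//.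
by rewrite le_measure// inE.
Qed.

Lemma fine_measure_leU (A B C : set X) : measurable A -> measurable B -> measurable C ->
  A `<=` B `|` C -> m A <= m B + m C.
Proof.
move=> mA mB mC ABC.
apply: (le_trans (fine_measure_le mA (measurableU _ _ mB mC) ABC)).
rewrite -lee_fin EFinD !fineK ?fin_num_measure//; last exact: measurableU.
exact: measureU2.
Qed.

Lemma fine_measure_null_eq (A B C : set X) : measurable A -> measurable B -> measurable C ->
  m C = 0 -> A `+` B `<=` C -> m A = m B.
Proof.
move=> mA mB mC C0 AB; apply/eqP; rewrite eq_le; apply/andP; split.
  rewrite -[m B]addr0 -C0; apply: fine_measure_leU => // x Ax.
  by have [Bx|nBx] := pselect (B x); [left|right; apply: AB; left].
rewrite -[m A]addr0 -C0; apply: fine_measure_leU => // x Bx.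
by have [Ax|nAx] := pselect (A x); [left|right; apply: AB; right].
Qed.

Local Open Scope quotient_scope.

(** [malg_set] picks an arbitrary representative of the class, which agrees with [A] only up to a
    null set; the rules for computing on classes rest on this. *)
Lemma malg_set_class (A : set X) (mA : measurable A) :
  m (malg_set (malg_class mu mA) `+` A) = 0.
Proof.
rewrite /malg_set /malg_class; case: piP => B /eqmodP/=.
by rewrite /null_equal setYC => /eqP ->.
Qed.

Lemma mdist_malg_class (A B : set X) (mA : measurable A) (mB : measurable B) :
  mdist (malg_class mu mA : M) (malg_class mu mB) = m (A `+` B).
Proof.
have mA' := malg_setP (malg_class mu mA); have mB' := malg_setP (malg_class mu mB).
have mAA' := measurableY mA' mA; have mBB' := measurableY mB' mB.
apply: (@fine_measure_null_eq _ _ ((malg_set (malg_class mu mA) `+` A) `|`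
  (malg_set (malg_class mu mB) `+` B))).
- exact: measurableY.
- exact: measurableY.
- exact: measurableU.
- apply/eqP; rewrite eq_le fine_ge0//= andbT -[leRHS]addr0.
  rewrite -{1}(malg_set_class mA) -(malg_set_class mB).
  by apply: fine_measure_leU => //; exact: measurableU.
move=> x /=; have := EM (A x); have := EM (B x).
have := EM (malg_set (malg_class mu mA) x); have := EM (malg_set (malg_class mu mB) x).
by tauto.
Qed.

Lemma malg_class_eq (A B : set X) (mA : measurable A) (mB : measurable B) :
  m (A `+` B) = 0 -> malg_class mu mA = malg_class mu mB.
Proof. by move=> AB; apply: (@mdist_positivity R M); rewrite mdist_malg_class. Qed.

Lemma malg_class_congr (A B : set X) (mA : measurable A) (mB : measurable B) :
  A = B -> malg_class mu mA = malg_class mu mB.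
Proof. by move=> AB; apply: malg_class_eq; rewrite AB setYK measure0. Qed.

Lemma malg_setK (a : malg mu) : malg_class mu (malg_setP a) = a.
Proof.
by apply: (@mdist_positivity R M); exact: malg_set_class.
Qed.

Lemma malg_measure_class (A : set X) (mA : measurable A) :
  malg_measure (malg_class mu mA) = m A.
Proof.
have mA' := malg_setP (malg_class mu mA).
by apply: fine_measure_null_eq (malg_set_class mA) _ => //; exact: measurableY.
Qed.

(** By [op_local] the operation is pointwise, so changing representatives alters the result at most
    where one of them changed, a null set. *)
Lemma malg_op_class (op : set X -> set X -> set X)
    (mop : forall A B, measurable A -> measurable B -> measurable (op A B))
    (op_local : forall A A' B B' x, (A x <-> A' x) -> (B x <-> B' x) ->
      (op A B x <-> op A' B' x))
    (A B : set X) (mA : measurable A) (mB : measurable B) :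
  malg_class mu (mop _ _ (malg_setP (malg_class mu mA)) (malg_setP (malg_class mu mB))) =
  malg_class mu (mop _ _ mA mB).
Proof.
have mA' := malg_setP (malg_class mu mA); have mB' := malg_setP (malg_class mu mB).
apply: malg_class_eq; apply/eqP; rewrite eq_le fine_ge0//= andbT -[leRHS]addr0.
rewrite -{1}(malg_set_class mA) -(malg_set_class mB).
apply: fine_measure_leU.
- by apply: measurableY; exact: mop.
- exact: measurableY.
- exact: measurableY.
move=> x /=.
have := op_local (malg_set (malg_class mu mA)) A (malg_set (malg_class mu mB)) B x.
have := EM (A x); have := EM (B x).
have := EM (malg_set (malg_class mu mA) x); have := EM (malg_set (malg_class mu mB) x).
by tauto.
Qed.

Lemma malg_union_class (A B : set X) (mA : measurable A) (mB : measurable B) :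
  malg_union (malg_class mu mA) (malg_class mu mB) = malg_class mu (measurableU _ _ mA mB).
Proof.
rewrite /malg_union.
by apply: (@malg_op_class setU (@measurableU _ _)) => A' A'' B' B'' x /=; tauto.
Qed.

Lemma malg_inter_class (A B : set X) (mA : measurable A) (mB : measurable B) :
  malg_inter (malg_class mu mA) (malg_class mu mB) = malg_class mu (measurableI _ _ mA mB).
Proof.
by apply: (@malg_op_class setI (@measurableI _ _)) => A' A'' B' B'' x /=; tauto.
Qed.

Lemma malg_symdiffE (a b : malg mu) :
  malg_symdiff a b = malg_class mu (measurableY (malg_setP a) (malg_setP b)).
Proof. exact: malg_class_congr. Qed.

Lemma malg_symdiff_class (A B : set X) (mA : measurable A) (mB : measurable B) :
  malg_symdiff (malg_class mu mA) (malg_class mu mB) = malg_class mu (measurableY mA mB).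
Proof.
rewrite malg_symdiffE.
by apply: (@malg_op_class setY measurableY) => A' A'' B' B'' x /=; tauto.
Qed.

(** * Automorphisms induced by measure preserving maps *)

Section measure_preserving_map.
Variables f : X -> X.
Hypothesis mf : forall A, measurable A -> measurable (f @^-1` A).
Hypothesis muf : forall A, measurable A -> mu (f @^-1` A) = mu A.

Definition malg_preimage (a : malg mu) : malg mu := malg_class mu (mf (malg_setP a)).

Lemma malg_preimage_class (A : set X) (mA : measurable A) :
  malg_preimage (malg_class mu mA) = malg_class mu (mf mA).
Proof.
apply: malg_class_eq; rewrite -(malg_set_class mA) -(muf (measurableY (malg_setP _) mA)).
by [].
Qed.

End measure_preserving_map.

(** Preimages commute with the set operations, and the preimage under the inverse point map is the
    inverse. *)
Lemma malg_preimage_automorphism (f f' : X -> X)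
    (mf : forall A, measurable A -> measurable (f @^-1` A))
    (mf' : forall A, measurable A -> measurable (f' @^-1` A)) :
  (forall A, measurable A -> mu (f @^-1` A) = mu A) ->
  (forall A, measurable A -> mu (f' @^-1` A) = mu A) ->
  cancel f f' -> cancel f' f -> automorphism (M := M) (malg_preimage mf).
Proof.
move=> muf muf' fK f'K; split.
- exists (malg_preimage mf') => a.
    rewrite {2}/malg_preimage malg_preimage_class// -[RHS]malg_setK.
    by apply: malg_class_congr; apply/funext => x /=; rewrite f'K.
  rewrite {2}/malg_preimage malg_preimage_class// -[RHS]malg_setK.
  by apply: malg_class_congr; apply/funext => x /=; rewrite fK.
- move=> a b; rewrite mdist_malg_class.
  have mab := measurableY (malg_setP a) (malg_setP b).
  by rewrite -[RHS](congr1 (fun r => fine r) (muf _ mab)).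
- have opE (op : set X -> set X -> set X)
      (mop : forall A B, measurable A -> measurable B -> measurable (op A B)) (a b : malg mu) :
      (forall A B, f @^-1` (op A B) = op (f @^-1` A) (f @^-1` B)) ->
      malg_preimage mf (malg_class mu (mop _ _ (malg_setP a) (malg_setP b))) =
      malg_class mu (mop _ _ (mf _ (malg_setP a)) (mf _ (malg_setP b))).
    by move=> fop; rewrite malg_preimage_class//; exact: malg_class_congr.
  case=> x /=.
  + by rewrite malg_preimage_class//; exact: malg_class_congr.
  + by rewrite malg_preimage_class//; exact: malg_class_congr.
  + rewrite [RHS]malg_union_class.
    exact: (opE setU (fun A B mA mB => measurableU A B mA mB)).
  + rewrite [RHS]malg_inter_class.
    exact: (opE setI (fun A B mA mB => measurableI A B mA mB)).
  + rewrite [RHS]malg_symdiff_class malg_symdiffE.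
    exact: (opE setY (fun A B mA mB => measurableY mA mB)).
- by move=> r x /=; rewrite malg_measure_class muf//; exact: malg_setP.
Qed.

End measure_algebra_theory.

(** * Interval exchanges *)

Lemma measurable_shift (R : realType) (c : R) (A : set (measurableTypeR R)) :
  measurable A -> measurable ((fun x : measurableTypeR R => x + c) @^-1` A).
Proof.
move=> mA; rewrite -[X in measurable X]setTI.
by apply: (measurable_funD (@measurable_id _ _ setT) (measurable_cst c)) => //.
Qed.

(** The pushforward by the shift agrees with Lebesgue measure on half-open intervals, which
    determine it. *)
Lemma lebesgue_measure_shift (R : realType) (c : R) (A : set (measurableTypeR R)) :
  measurable A ->
  lebesgue_measure ((fun x : measurableTypeR R => x + c) @^-1` A) = lebesgue_measure A.
Proof.
pose f := (fun x : measurableTypeR R => x + c : measurableTypeR R).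
have mf : measurable_fun setT f by apply: measurable_funD.
move=> mA; rewrite [LHS](_ : _ = pushforward lebesgue_measure f A)//.
apply/esym/lebesgue_measure_unique => // _ [[a b] _ <-].
rewrite [RHS](_ : _ = lebesgue_measure `]a - c, b - c]%classic).
  by rewrite !lebesgue_measure_itv/= !lte_fin ltrD2r -!EFinD opprB addrA subrK.
by congr lebesgue_measure; apply/seteqP; split=> x /=; rewrite !in_itv/= ltrBlDr lerBrDr.
Qed.

Section grid.
Context (R : realType) (n : nat).
Local Notation N := n.+1.
Implicit Types (i j : 'I_N) (p : {perm 'I_N}) (x : R).

(** Half-open, so that the cells partition [[0, 1[]; the endpoint 1 lies in none of them. *)
Definition cell j : set R := `[j%:R / N%:R, j.+1%:R / N%:R[%classic.

Let N0 : 0 < N%:R :> R. Proof. by rewrite ltr0n. Qed.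

Lemma cellP j x : cell j x <-> j%:R <= x * N%:R < j.+1%:R.
Proof. by rewrite /cell /= in_itv/= ler_pdivrMr// ltr_pdivlMr. Qed.

Lemma cell_inj i j x : cell i x -> cell j x -> i = j.
Proof.
move=> /cellP/andP[i1 i2] /cellP/andP[j1 j2]; apply: val_inj; apply/eqP.
have := le_lt_trans i1 j2; have := le_lt_trans j1 i2.
by rewrite !ltr_nat !ltnS eqn_leq => -> ->.
Qed.

Lemma measurable_cell j : measurable (cell j : set (measurableTypeR R)).
Proof. exact: measurable_itv. Qed.

Lemma lebesgue_measure_cell j : lebesgue_measure (cell j) = (N%:R^-1)%:E :> \bar R.
Proof.
rewrite lebesgue_measure_itv/= lte_fin ltr_pM2r ?invr_gt0// ltr_nat ltnSn.
by rewrite -EFinB -mulrBl -natrB// subSnn mul1r.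
Qed.

Lemma cell01 j x : cell j x -> 0 <= x < 1.
Proof.
move=> /cellP/andP[jx xj]; apply/andP; split.
  by rewrite -(pmulr_lge0 _ N0) (le_trans _ jx).
rewrite -(ltr_pM2r N0) mul1r (lt_le_trans xj)// ler_nat; exact: ltn_ord.
Qed.

Lemma exists_cell x : 0 <= x < 1 -> exists j, cell j x.
Proof.
move=> /andP[x0 x1]; have xN0 : 0 <= x * N%:R by rewrite mulr_ge0.
have /andP[t1 t2] := truncn_itv xN0.
have jN : (Num.truncn (x * N%:R) < N)%N.
  by rewrite -(ltr_nat R) (le_lt_trans t1)// -[ltRHS]mul1r ltr_pM2r.
by exists (Ordinal jN); apply/cellP; rewrite t1.
Qed.

(** Cell [j] is translated onto cell [p j]. Fixing the points outside [[0, 1[] makes this a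
    bijection of the line that preserves [[0, 1]]. *)
Definition exchange p x : R :=
  if [pick j | `[< cell j x >]] is Some j then x + ((p j)%:R - j%:R) / N%:R else x.

Lemma exchangeE p j x : cell j x -> exchange p x = x + ((p j)%:R - j%:R) / N%:R.
Proof.
rewrite /exchange => jx; case: pickP => [i /asboolP ix|/(_ j)].
  by rewrite (cell_inj ix jx).
by move/asboolP.
Qed.

Lemma exchange_out p x : ~ (0 <= x < 1) -> exchange p x = x.
Proof. by rewrite /exchange => x01; case: pickP => // j /asboolP/cell01. Qed.

Lemma cell_shift i j x : cell j x -> cell i (x + (i%:R - j%:R) / N%:R).
Proof.
move=> /cellP/andP[j1 j2]; apply/cellP; rewrite mulrDl divfK ?gt_eqF//.
by move: j1 j2; rewrite -!natr1 => *; apply/andP; split; lra.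
Qed.

Lemma exchange_cell p j x : cell j x -> cell (p j) (exchange p x).
Proof. by move=> jx; rewrite (exchangeE _ jx); exact: cell_shift. Qed.

Lemma exchangeK p : cancel (exchange p) (exchange p^-1%g).
Proof.
move=> x; have [x01|x01] := pselect (0 <= x < 1); last by rewrite !exchange_out.
have [j jx] := exists_cell x01.
rewrite (exchangeE _ (exchange_cell p jx)) (exchangeE _ jx) permK.
by rewrite -addrA -mulrDl addrA subrK subrr mul0r addr0.
Qed.

Lemma exchange01 p x : 0 <= x <= 1 -> 0 <= exchange p x <= 1.
Proof.
move=> x01; have [{}x01|nx01] := pselect (0 <= x < 1); last by rewrite exchange_out.
have [j jx] := exists_cell x01.
by have /andP[-> /ltW] := cell01 (exchange_cell p jx).
Qed.

Lemma cover_cells (A : set R) : A = (A `\` `[0, 1[%classic) `|`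
  \big[setU/set0]_j (A `&` cell j).
Proof.
rewrite -bigcup_pred; apply/seteqP; split=> [x Ax|x [[]//|[j _ []//]]].
have [x01|x01] := pselect (0 <= x < 1).
  by right; have [j jx] := exists_cell x01; exists j.
by left; split=> //; rewrite /= in_itv.
Qed.

Lemma trivIset_cells (A : set R) : trivIset setT (fun j => A `&` cell j).
Proof. by move=> i j _ _ [x [[_ ix] [_ jx]]]; exact: cell_inj ix jx. Qed.

End grid.

Section grid_measure.
Context (R : realType) (n : nat).
Local Notation N := n.+1.
Implicit Types (i j : 'I_N) (p : {perm 'I_N}) (S : {set 'I_N}).
Implicit Types (A B : set (measurableTypeR R)).
Local Notation lambda := (@lebesgue_measure R).

Lemma lebesgue_measure_cover_cells A : measurable A ->
  lambda A = (lambda (A `\` `[0%R, 1%R[%classic) + \sum_(j < N) lambda (A `&` cell j))%E.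
Proof.
move=> mA; have mc j : measurable (A `&` cell j).
  by apply: measurableI => //; exact: measurable_cell.
rewrite [A in LHS](cover_cells n) measureU.
- by rewrite (measure_bigsetU_ord _ _ mc)//; exact: trivIset_cells.
- by apply: measurableD.
- exact: bigsetU_measurable.
rewrite -bigcup_pred -subset0 => x [[_ nx] [j _ [_ /cell01]]].
by move: nx; rewrite /= in_itv.
Qed.

(** On a single cell the exchange is a translation, which reduces measurability and invariance of
    the measure to those of shifts. *)
Lemma exchange_preimage_cell p A j : exchange p @^-1` A `&` cell j =
  (fun x => x + ((p j)%:R - j%:R) / N%:R) @^-1` (A `&` cell (p j)).
Proof.
apply/seteqP; split=> x /= [Ax jx].
  by rewrite -(exchangeE p jx); split=> //; exact: exchange_cell.
have {}jx : cell j x.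
  have := cell_shift j jx; rewrite -addrA -mulrDl addrA subrK subrr mul0r addr0.
  exact.
by rewrite (exchangeE p jx).
Qed.

Lemma exchange_preimage_out p A :
  exchange p @^-1` A `\` `[0, 1[%classic = A `\` `[0, 1[%classic.
Proof.
by apply/seteqP; split=> x /= [Ax]; rewrite in_itv/= => nx; move: Ax;
  rewrite exchange_out.
Qed.

Lemma measurable_exchange p A : measurable A ->
  measurable (exchange p @^-1` A : set (measurableTypeR R)).
Proof.
move=> mA; rewrite [X in measurable X](cover_cells n) exchange_preimage_out.
apply: measurableU; first exact: measurableD.
apply: bigsetU_measurable => j _; rewrite exchange_preimage_cell.
apply: measurable_shift; apply: measurableI => //; exact: measurable_cell.
Qed.

Lemma lebesgue_measure_exchange p A : measurable A -> lambda (exchange p @^-1` A) = lambda A.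
Proof.
move=> mA; rewrite lebesgue_measure_cover_cells; last exact: measurable_exchange.
rewrite exchange_preimage_out [RHS]lebesgue_measure_cover_cells//; congr adde.
rewrite [RHS](reindex_inj (@perm_inj _ p))/=; apply: eq_bigr => j _.
rewrite exchange_preimage_cell lebesgue_measure_shift//.
by apply: measurableI => //; exact: measurable_cell.
Qed.

Definition cells S : set (measurableTypeR R) := \bigcup_(j in [set` S]) cell j.

Lemma measurable_cells S : measurable (cells S).
Proof.
rewrite /cells bigcup_pred; apply: bigsetU_measurable => j _; exact: measurable_cell.
Qed.

Lemma lebesgue_measure_cells S : lambda (cells S) = (#|S|%:R / N%:R)%:E.
Proof.
rewrite /cells bigcup_pred (measure_bigsetU_ord _ _ (@measurable_cell R n)).
  rewrite (eq_bigr (fun=> (N%:R^-1)%:E)) => [|j _]; last exact: lebesgue_measure_cell.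
  by rewrite sumEFin sumr_const mulr_natl.
by move=> i j _ _ [x [ix jx]]; exact: cell_inj ix jx.
Qed.

Lemma cellsE j x S : cell j x -> cells S x <-> j \in S.
Proof.
move=> jx; split=> [[i iS ix]|jS]; last by exists j.
by rewrite (cell_inj jx ix).
Qed.

Lemma cells01 S x : cells S x -> 0 <= x < 1.
Proof. by move=> [j _ /cell01]. Qed.

(** Reduces the Boolean identities and the preimage formula below to membership of one index, cell
    by cell. *)
Lemma cells_ext S (C : set R) : (forall x, C x -> 0 <= x < 1) ->
  (forall j x, cell j x -> C x <-> j \in S) -> C = cells S.
Proof.
move=> C01 CS; apply/seteqP; split=> x.
  by move=> Cx; have [j jx] := exists_cell n (C01 x Cx); apply/(cellsE S jx)/(CS j x jx).
by move=> [j jS jx]; apply/(CS j x jx).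
Qed.

Lemma cellsI S S' : cells S `&` cells S' = cells (S :&: S').
Proof.
apply: cells_ext => [x [/cells01]//|j x jx]; split=> [[]|].
  by move=> /(cellsE S jx) jS /(cellsE S' jx) jS'; rewrite inE jS.
by rewrite inE => /andP[? ?]; split; apply/(cellsE _ jx).
Qed.

Lemma cellsU S S' : cells S `|` cells S' = cells (S :|: S').
Proof.
apply: cells_ext => [x [|]/cells01//|j x jx]; split=> [[]|].
- by move=> /(cellsE S jx) jS; rewrite inE jS.
- by move=> /(cellsE S' jx) jS; rewrite inE jS orbT.
- by rewrite inE => /orP[?|?]; [left|right]; apply/(cellsE _ jx).
Qed.

Lemma cellsD S S' : cells S `\` cells S' = cells (S :\: S').
Proof.
apply: cells_ext => [x [/cells01]//|j x jx]; split=> [[]|].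
  move=> /(cellsE S jx) jS; rewrite inE jS andbT => nS'; apply/negP => jS'.
  by apply: nS'; apply/(cellsE _ jx).
rewrite inE => /andP[jS' jS]; split; first exact/(cellsE _ jx).
by move=> /(cellsE S' jx); apply/negP.
Qed.

Lemma cellsY S S' : cells S `+` cells S' = cells ((S :\: S') :|: (S' :\: S)).
Proof. by rewrite -cellsU -!cellsD. Qed.

Lemma exchange_preimage_cells p S : exchange p @^-1` cells S = cells (p @^-1: S).
Proof.
apply: cells_ext => [x|j x jx] /=.
  have [//|nx] := pselect (0 <= x < 1).
  by rewrite exchange_out// => /cells01.
rewrite inE; have := cellsE S (exchange_cell p jx); exact.
Qed.

End grid_measure.

(** * Transfer to the unit interval and its measure algebra *)

Section unit_interval_exchange.
Context (R : realType).
Local Notation X := (unit_interval R).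
Local Notation lambda := (@lebesgue_measure R).
Implicit Types B : set (measurableTypeR R).

Lemma in_line01 (x : X) : 0 <= in_line x <= 1.
Proof. by have := @set_valP _ `[0 : R, 1]%classic x; rewrite /= in_itv. Qed.

Definition of_line (x : R) (x01 : 0 <= x <= 1) : X :=
  exist _ x (mem_set (x01 : `[0 : R, 1]%classic x)).

Lemma in_line_inj : injective (@in_line R : X -> R).
Proof. by move=> x y h; apply: val_inj. Qed.

Lemma measurable_in_line B : measurable B -> measurable (@in_line R @^-1` B : set X).
Proof. by move=> mB; exists B => //; rewrite setTI. Qed.

Lemma unit_interval_measurableP (A : set X) : measurable A ->
  exists2 B, measurable B & A = @in_line R @^-1` B.
Proof. by move=> [B mB <-]; exists B => //; rewrite setTI. Qed.

Lemma lebesgue01_in_line B :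
  lebesgue01 (@in_line R @^-1` B : set X) = lambda (B `&` `[0, 1]%classic).
Proof.
rewrite /lebesgue01; congr (lambda _); apply/seteqP; split=> [_ [x Bx <-]|x [Bx x01]].
  by split=> //=; rewrite in_itv/=; exact: in_line01.
by move: x01; rewrite /= in_itv/= => x01; exists (of_line x01).
Qed.

Variable n : nat.
Local Notation N := n.+1.
Implicit Types (p : {perm 'I_N}) (S : {set 'I_N}).

Definition interval_exchange p (x : X) : X := of_line (exchange01 p (in_line01 x)).

Lemma in_line_interval_exchange p B :
  interval_exchange p @^-1` (@in_line R @^-1` B) = @in_line R @^-1` (exchange p @^-1` B).
Proof. by []. Qed.

Lemma interval_exchangeK p : cancel (interval_exchange p) (interval_exchange p^-1%g).
Proof. by move=> x; apply: in_line_inj; exact: exchangeK. Qed.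

Lemma measurable_interval_exchange p (A : set X) : measurable A ->
  measurable (interval_exchange p @^-1` A).
Proof.
move=> /unit_interval_measurableP[B mB ->].
exact: (measurable_in_line (measurable_exchange p mB)).
Qed.

Lemma lebesgue01_interval_exchange p (A : set X) : measurable A ->
  lebesgue01 (interval_exchange p @^-1` A) = lebesgue01 A.
Proof.
move=> /unit_interval_measurableP[B mB ->].
rewrite in_line_interval_exchange !lebesgue01_in_line.
rewrite -[RHS](lebesgue_measure_exchange p); last exact: measurableI.
congr (lambda _); rewrite preimage_setI; congr setI.
apply/seteqP; split=> x /=; rewrite !in_itv/=; first exact: exchange01.
by move=> /(exchange01 p^-1%g); rewrite exchangeK.
Qed.

Local Notation M := (MAlg (@lebesgue01 R)).

Definition grid_set S : set X := @in_line R @^-1` cells S.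

Lemma measurable_grid_set S : measurable (grid_set S).
Proof. by apply: measurable_in_line; exact: measurable_cells. Qed.

Lemma lebesgue01_grid_set S : lebesgue01 (grid_set S) = (#|S|%:R / N%:R)%:E.
Proof.
rewrite lebesgue01_in_line setIidl ?lebesgue_measure_cells// => x /cells01/andP[x0 x1].
by rewrite /= in_itv/= x0 ltW.
Qed.

Definition grid_class S : M := malg_class (@lebesgue01 R) (measurable_grid_set S).

Lemma grid_class_eq S (A : set X) (mA : measurable A) :
  A = grid_set S -> malg_class (@lebesgue01 R) mA = grid_class S.
Proof. exact: malg_class_congr. Qed.

Lemma malg_measure_grid_class S : malg_measure (grid_class S) = #|S|%:R / N%:R.
Proof. by rewrite malg_measure_class /= lebesgue01_grid_set. Qed.

Lemma mdist_grid_class S S' :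
  mdist (grid_class S) (grid_class S') = #|(S :\: S') :|: (S' :\: S)|%:R / N%:R.
Proof.
rewrite mdist_malg_class -[RHS]/(fine (EFin _)) -lebesgue01_grid_set.
by rewrite /grid_set -cellsY.
Qed.

Lemma malg_inter_grid_class S S' :
  malg_inter (grid_class S) (grid_class S') = grid_class (S :&: S').
Proof.
by rewrite malg_inter_class; apply: grid_class_eq; rewrite /grid_set -cellsI.
Qed.

Lemma malg_union_grid_class S S' :
  malg_union (grid_class S) (grid_class S') = grid_class (S :|: S').
Proof.
by rewrite malg_union_class; apply: grid_class_eq; rewrite /grid_set -cellsU.
Qed.

Lemma malg_symdiff_grid_class S S' :
  malg_symdiff (grid_class S) (grid_class S') = grid_class ((S :\: S') :|: (S' :\: S)).
Proof.
by rewrite malg_symdiff_class; apply: grid_class_eq; rewrite /grid_set -cellsY.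
Qed.

(** The union of all cells misses the endpoint 1, so the underlying sets agree only up to a null
    set. *)
Lemma malg_class_setT : malg_class (@lebesgue01 R) measurableT = grid_class [set: 'I_N]%SET.
Proof.
apply: malg_class_eq; rewrite setYC setYTC; apply/eqP.
rewrite -eqe fineK ?fin_num_measure//; last first.
  by apply: measurableC; exact: measurable_grid_set.
have := @probability_setC _ _ _ (@lebesgue01 R) _ (measurable_grid_set [set: 'I_N]%SET).
move=> ->; rewrite [X in (1 - X)%E]lebesgue01_grid_set cardsT card_ord divff ?pnatr_eq0//.
by rewrite subee.
Qed.

Definition exchange_automorphism p : M -> M :=
  malg_preimage (mu := @lebesgue01 R) (@measurable_interval_exchange p).

Lemma exchange_automorphismP p : automorphism (exchange_automorphism p).
Proof.
apply: (@malg_preimage_automorphism _ _ _ _ _ (interval_exchange p^-1%g)).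
- exact: measurable_interval_exchange.
- exact: lebesgue01_interval_exchange.
- exact: lebesgue01_interval_exchange.
- exact: interval_exchangeK.
- by have := interval_exchangeK p^-1%g; rewrite invgK.
Qed.

Lemma exchange_automorphism_grid p S :
  exchange_automorphism p (grid_class S) = grid_class (p @^-1: S).
Proof.
rewrite /exchange_automorphism malg_preimage_class; last exact: lebesgue01_interval_exchange.
by apply: grid_class_eq; rewrite /grid_set in_line_interval_exchange exchange_preimage_cells.
Qed.

End unit_interval_exchange.

(** * Density of the unions of cells *)

Section grid_density.
Context (R : realType).
Local Notation X := (unit_interval R).
Local Notation lambda := (@lebesgue_measure R).
Local Notation M := (MAlg (@lebesgue01 R)).
Local Notation mclass := (malg_class (@lebesgue01 R)).

Lemma mdist_malg_union_le (a a' b b' : M) :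
  mdist (malg_union a b : M) (malg_union a' b') <= mdist a a' + mdist b b'.
Proof.
have := @finterp_modulus R _ M MUnion (fun i : 'I_2 => if i == ord0 then a else b)
  (fun i : 'I_2 => if i == ord0 then a' else b').
by rewrite /sum_dist /= big_ord_recl big_ord1.
Qed.

Lemma mdist_malg_symdiff_le (a a' b b' : M) :
  mdist (malg_symdiff a b : M) (malg_symdiff a' b') <= mdist a a' + mdist b b'.
Proof.
have := @finterp_modulus R _ M MSymDiff (fun i : 'I_2 => if i == ord0 then a else b)
  (fun i : 'I_2 => if i == ord0 then a' else b').
by rewrite /sum_dist /= big_ord_recl big_ord1.
Qed.

(** Asking for all large [n], not just for one, allows several elements to be approximated on a
    common grid. *)
Definition grid_approximable (a : M) := forall e : R, 0 < e -> exists n0, forall n,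
  (n0 <= n)%N -> exists S : {set 'I_n.+1}, mdist a (grid_class R S) < e.

Lemma grid_approximable_closed (a : M) :
  (forall e : R, 0 < e -> exists2 b, grid_approximable b & mdist a b < e) ->
  grid_approximable a.
Proof.
move=> h e e0; have e20 : 0 < e / 2 by rewrite divr_gt0.
have [b /(_ _ e20)[n0 hb] ab] := h _ e20; exists n0 => n /hb[S bS]; exists S.
by rewrite (splitr e) (le_lt_trans (metric_triangle _ b _))// ltrD.
Qed.

Lemma grid_approximable_union (a b : M) :
  grid_approximable a -> grid_approximable b -> grid_approximable (malg_union a b).
Proof.
move=> ha hb e e0; have e20 : 0 < e / 2 by rewrite divr_gt0.
have [n1 h1] := ha _ e20; have [n2 h2] := hb _ e20; exists (maxn n1 n2) => n.
rewrite geq_max => /andP[/h1[S aS] /h2[S' bS']]; exists (S :|: S')%SET.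
rewrite -malg_union_grid_class (splitr e).
by rewrite (le_lt_trans (mdist_malg_union_le _ _ _ _))// ltrD.
Qed.

Lemma grid_approximable_compl (a : M) :
  grid_approximable a -> grid_approximable (malg_symdiff a (mclass measurableT)).
Proof.
move=> ha e e0; have [n1 h1] := ha _ e0; exists n1 => n /h1[S aS].
exists ((S :\: [set: 'I_n.+1]) :|: ([set: 'I_n.+1] :\: S))%SET.
rewrite (malg_class_setT R n) -malg_symdiff_grid_class.
by rewrite (le_lt_trans (mdist_malg_symdiff_le _ _ _ _))// mdistxx addr0.
Qed.

Lemma grid_approximable_set0 (A : set X) (mA : measurable A) :
  A = set0 -> grid_approximable (mclass mA).
Proof.
move=> A0 e e0; exists 0%N => n _; exists finset.set0.
by rewrite mdist_malg_class A0 set0Y /= lebesgue01_grid_set cards0 mul0r.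
Qed.

Lemma grid_approximable_ray (t : R) (mA : measurable (@in_line R @^-1` `]t, +oo[ : set X)) :
  grid_approximable (mclass mA).
Proof.
move=> e e0; have [n0 _ hn0] := near_infty_natSinv_lt (PosNum e0).
(* The cells whose left endpoint exceeds [t] lie in the ray, and miss at most the part of it in the
   cell containing [t], and the point 1. *)
exists n0 => n n0n; exists [set j : 'I_n.+1 | t < j%:R / n.+1%:R]%SET.
rewrite mdist_malg_class; set S := [set j | _]%SET.
apply: le_lt_trans (hn0 n n0n); rewrite -lee_fin fineK; last first.
  by rewrite fin_num_measure//; apply: measurableY => //; exact: measurable_grid_set.
have mI : measurable (`]t, t + n.+1%:R^-1[ `|` [set 1] : set (measurableTypeR R)).
  by apply: measurableU; [exact: measurable_itv|exact: measurable_set1].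
apply: (@le_trans _ _ (lebesgue01
    (@in_line R @^-1` (`]t, t + n.+1%:R^-1[ `|` [set 1]) : set X))).
  apply: le_measure; rewrite ?inE//.
  - by apply: measurableY => //; exact: measurable_grid_set.
  - exact: measurable_in_line.
  have N0 : 0 < n.+1%:R :> R by rewrite ltr0n.
  move=> x /= [[]|[]]; rewrite in_itv/= andbT => tx.
    move=> nS; have /andP[x0 x1] := in_line01 x.
    have [x1'|] := ltP (in_line x) 1; last by move=> x1'; right; apply/eqP; rewrite eq_le x1.
    left; rewrite in_itv/= tx/=.
    have [j jx] : exists j : 'I_n.+1, cell j (in_line x) by apply: exists_cell; rewrite x0.
    have : ~~ (t < j%:R / n.+1%:R).
      by apply/negP => tj; apply: nS; apply/(cellsE S jx); rewrite inE.
    rewrite -leNgt => jt; move/cellP: jx => /andP[_].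
    rewrite -ltr_pdivlMr// => /lt_le_trans; apply.
    by rewrite -natr1 mulrDl mul1r lerD2r.
  case: tx => j /=; rewrite inE => tj /cellP/andP[jx _] [].
  by apply: lt_le_trans tj _; rewrite ler_pdivrMr.
rewrite lebesgue01_in_line.
apply: (@le_trans _ _ (lambda (`]t, t + n.+1%:R^-1[ `|` [set 1]))).
  by apply: le_measure; rewrite ?inE//; apply: measurableI.
apply: (le_trans (measureU2 _ _ _)) => //.
rewrite [X in (_ + X)%E](lebesgue_measure_set1 1) adde0.
rewrite [X in (X <= _)%E](lebesgue_measure_itv `]t, t + n.+1%:R^-1[)/= lte_fin ltrDl.
by rewrite invr_gt0 ltr0Sn -EFinB addrAC subrr add0r.
Qed.

(** The Borel sets of the line whose trace is approximable form a sigma-algebra containing the rays,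
    which generate all Borel sets. *)
Lemma grid_approximable_malg (a : M) : grid_approximable a.
Proof.
pose P (B : set (measurableTypeR R)) := measurable B /\
  forall mA : measurable (@in_line R @^-1` B : set X), grid_approximable (mclass mA).
suff PB B : measurable B -> P B.
  rewrite -(malg_setK a); have [B mB aB] := unit_interval_measurableP (malg_setP a).
  rewrite (@malg_class_congr _ _ _ (@lebesgue01 R) _ _ _ (measurable_in_line mB))//.
  by have [_] := PB B mB; exact.
suff : (@RGenOInfty.G R).-sigma.-measurable `<=` P.
  by rewrite -RGenOInfty.measurableE; exact.
move=> {B}; apply: smallest_sub; last first.
  by move=> _ [t ->]; split; [exact: measurable_itv|exact: grid_approximable_ray].
split.
- by split=> // mA; apply: grid_approximable_set0; rewrite preimage_set0.
- move=> B [mB hB]; split=> [|mA]; first exact: measurableD.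
  have mB' := measurable_in_line mB.
  rewrite (_ : mclass mA = malg_symdiff (mclass mB') (mclass measurableT)).
    exact/grid_approximable_compl/hB.
  by rewrite malg_symdiff_class; apply: malg_class_congr; rewrite setYTC setTD.
move=> B hB; have mB i : measurable (B i : set (measurableTypeR R)) by have [] := hB i.
split=> [|mA]; first exact: bigcupT_measurable.
(* A countable union is the limit of the finite ones by continuity of the measure from below, and
   [grid_approximable_closed] applies. *)
pose C i : set (measurableTypeR R) := \big[setU/set0]_(j < i) B j.
have mC i : measurable (C i) by exact: bigsetU_measurable.
have mC' i := measurable_in_line (mC i).
have hC i : grid_approximable (mclass (mC' i)).
  elim: i => [|i IH].
    by apply: grid_approximable_set0; rewrite /C big_ord0 preimage_set0.
  have mBi := measurable_in_line (mB i).
  rewrite (_ : mclass _ = malg_union (mclass (mC' i)) (mclass mBi)).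
    by apply: grid_approximable_union => //; have [_] := hB i; exact.
  by rewrite malg_union_class; apply: malg_class_congr; rewrite /C big_ord_recr.
apply: grid_approximable_closed => e e0.
have UC : @in_line R @^-1` (\bigcup_i B i) = \bigcup_i (@in_line R @^-1` C i).
  rewrite -preimage_bigcup; congr (_ @^-1` _).
  apply/seteqP; split=> [x [i _ Bx]|x [i _]].
    by exists i.+1 => //; rewrite /C big_ord_recr; right.
  exact: (@bigsetU_bigcup _ B i x).
have mU : measurable (\bigcup_i (@in_line R @^-1` C i) : set X) by rewrite -UC.
have ndC : {homo (fun i => @in_line R @^-1` C i : set X) : i j / (i <= j)%N >-> (i <= j)%O}.
  move=> i j ij; rewrite subsetEset => x; exact: subset_bigsetU.
have /fine_cvgP[_ cvgC] : (lebesgue01 (@in_line R @^-1` C i : set X)) @[i --> \oo] -->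
    (fine (lebesgue01 (\bigcup_i (@in_line R @^-1` C i) : set X)))%:E.
  by rewrite fineK ?fin_num_measure//; exact: nondecreasing_cvg_mu.
move/cvgrPdist_lt: cvgC => /(_ _ e0)[i _ /(_ i (leqnn i)) hi].
exists (mclass (mC' i)); first exact: hC.
rewrite mdist_malg_class UC.
have Csub : @in_line R @^-1` C i `<=` \bigcup_i (@in_line R @^-1` C i).
  by move=> x Cx; exists i.
set U := \bigcup_i _ in mU hi Csub *; set Ci := @in_line R @^-1` C i in hi Csub *.
have -> : U `+` Ci = U `\` Ci.
  by apply/seteqP; split=> x; [case=> // -[/Csub]|left].
have mCi : measurable (Ci : set X) := mC' i.
rewrite measureD//; last by rewrite ltey_eq fin_num_measure.
rewrite setIidr// fineB ?fin_num_measure//.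
by apply: le_lt_trans hi; exact: ler_norm.
Qed.

End grid_density.

(** * Homogeneity of the measure algebra *)

Section minterms.
Context (R : realType).
Local Notation L := (malg_language R).
Local Notation M := (MAlg (@lebesgue01 R)).

Definition binary_args (t t' : term L) : 'I_2 -> term L :=
  fun i => if i == ord0 then t else t'.

Definition full_term : term L := @App R L MFull (fun=> Var 0).

(** The language has no symbol for complement; the symmetric difference with the full set replaces
    it. *)
Definition literal (b : bool) i : term L :=
  if b then Var i else @App R L MSymDiff (binary_args (Var i) full_term).

Fixpoint minterm (e : nat -> bool) k : term L :=
  if k is k'.+1 then @App R L MInter (binary_args (minterm e k') (literal (e k') k'))
  else full_term.

Definition minterm_measure k (e : k.-tuple bool) : formula L :=
  @Rel R L MMeasure (fun=> minterm (nth false e) k).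

Lemma term_var_minterm e k i : term_var (minterm e k) i -> (i < k)%N.
Proof.
elim: k => [[[]]//|k IH] /= [j]; rewrite /binary_args; case: ifP => _.
  by move=> /IH /ltnW.
rewrite /literal; case: (e k) => /=; first by move=> ->.
rewrite /binary_args => -[l]; case: ifP => _ /=; first by move=> ->.
by case; case.
Qed.

Lemma free_var_minterm_measure k (e : k.-tuple bool) i :
  free_var (minterm_measure e) i -> (i < k)%N.
Proof. by move=> [_ /term_var_minterm]. Qed.

Variables (n : nat) (S : nat -> {set 'I_n.+1}).

Lemma eval_minterm (s : nat -> M) e k :
  (forall i, (i < k)%N -> s i = grid_class R (S i)) ->
  eval_term M s (minterm e k) =
    grid_class R [set j | [forall i : 'I_k, (j \in S i) == e i]]%SET.
Proof.
elim: k => [|k IH] h.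
  rewrite [LHS](malg_class_setT R n); congr (grid_class R _).
  by apply/setP => j; rewrite !inE; apply/esym/forallP => -[].
have {}IH := IH (fun i ik => h i (ltnW ik)).
have sk : eval_term M s (literal (e k) k) =
    grid_class R [set j | (j \in S k) == e k]%SET.
  rewrite /literal; case: (e k) => /=.
    rewrite h//; congr (grid_class R _).
    by apply/setP => j; rewrite inE eqb_id.
  rewrite h// (malg_class_setT R n) malg_symdiff_grid_class; congr (grid_class R _).
  by apply/setP => j; rewrite !inE /= andbT; case: (j \in S k).
rewrite [LHS](_ : _ = malg_inter (eval_term M s (minterm e k))
  (eval_term M s (literal (e k) k)))//.
rewrite IH sk malg_inter_grid_class; congr (grid_class R _).
apply/setP => j; rewrite !inE; apply/andP/forallP => [[/forallP hj hk] i|hj].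
  have := ltn_ord i; rewrite ltnS leq_eqVlt => /predU1P[ik|ik]; first by rewrite ik.
  exact: (hj (Ordinal ik)).
split; last exact: (hj ord_max).
by apply/forallP => i; exact: (hj (widen_ord (leqnSn k) i)).
Qed.

(** On grid sets, the cells of color [e] make up the minterm of [e], so minterm measures become
    proportions of cells. *)
Definition color k (j : 'I_n.+1) : k.-tuple bool := [tuple j \in S i | i < k].

Lemma eval_minterm_measure (s : nat -> M) k (e : k.-tuple bool) :
  (forall i, (i < k)%N -> s i = grid_class R (S i)) ->
  eval M s (minterm_measure e) = #|[set j | color k j == e]%SET|%:R / n.+1%:R.
Proof.
move=> /eval_minterm h; rewrite [LHS](_ : _ =
  malg_measure (eval_term M s (minterm (nth false e) k)))//.
rewrite h malg_measure_grid_class; congr (_%:R / _); apply: eq_card => j.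
rewrite !inE; apply/forallP/eqP => [hj|<- i].
  by apply: eq_from_tnth => i; rewrite tnth_mktuple (eqP (hj i)) (tnth_nth false).
by rewrite -tnth_nth tnth_mktuple.
Qed.

End minterms.

Section malg_homogeneity.
Context (R : realType).
Local Notation L := (malg_language R).
Local Notation M := (MAlg (@lebesgue01 R)).

(** A cell whose colors match after [p] is in both sets or in neither, so the distance is at most
    the proportion of mismatches, to which each color contributes at most [d]. *)
Lemma grid_matching n k (S S' : nat -> {set 'I_n.+1}) (d : R) :
  (forall e : k.-tuple bool, `|#|[set j | color S k j == e]%SET|%:R / n.+1%:R
     - #|[set j | color S' k j == e]%SET|%:R / n.+1%:R| <= d) ->
  exists p : {perm 'I_n.+1}, forall i, (i < k)%N ->
    mdist (exchange_automorphism p (grid_class R (S i))) (grid_class R (S' i))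
      <= #|{: k.-tuple bool}|%:R * d.
Proof.
move=> h; have [p hp] := color_matching (color S k) (color S' k).
exists p => i ik; rewrite exchange_automorphism_grid mdist_grid_class.
have N0 : 0 < n.+1%:R :> R by rewrite ltr0n.
rewrite ler_pdivrMr//.
apply: (@le_trans _ _ (#|[set j | color S k (p j) != color S' k j]%SET|%:R)).
  rewrite ler_nat; apply/subset_leq_card/fintype.subsetP => j; rewrite !inE.
  apply: contraTneq => /(congr1 (fun t => tnth t (Ordinal ik))).
  by rewrite !tnth_mktuple /= => ->; case: (j \in S' i).
apply: (@le_trans _ _ (\sum_(e : k.-tuple bool) d * n.+1%:R)); last first.
  by rewrite sumr_const -[leLHS]mulr_natl mulrA.
move: hp; rewrite -(ler_nat R) natr_sum => /le_trans; apply.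
apply: ler_sum => e _; have := h e; rewrite -mulrBl normrM normfV (gtr0_norm N0).
rewrite ler_pdivrMr// => he.
have d0 : 0 <= d * n.+1%:R by apply: le_trans he.
(* A color in excess on the side of [S] contributes 0, the subtraction being truncated. *)
have [le_c|lt_c] := leqP #|[set j | color S' k j == e]%SET| #|[set j | color S k j == e]%SET|.
  by move: le_c; rewrite -subn_eq0 => /eqP ->.
rewrite natrB; last exact: ltnW.
by apply: le_trans he; rewrite distrC ler_norm.
Qed.

Lemma malg_finitely_homogeneous : finitely_homogeneous M.
Proof.
move=> k.
exists #|{: k.-tuple bool}|, (fun j => minterm_measure R (enum_val j)); split=> //.
  by move=> j i; exact: free_var_minterm_measure.
move=> e e0.
pose K : R := #|{: k.-tuple bool}|%:R + 1; have K0 : 0 < K by rewrite ltr_wpDl.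
(* Each color may be off by [3 * d] and [K] exceeds the number of colors, so the matching costs at
   most [e / 2]. *)
pose d := e / (6 * K); have d0 : 0 < d by rewrite divr_gt0// mulr_gt0.
exists d => // s s' ss'.
pose P (x : k.-tuple bool) r := forall t t' : nat -> M,
  (forall i, (i < k)%N -> mdist (t i) (t' i) < r) ->
  `|eval M t (minterm_measure R x) - eval M t' (minterm_measure R x)| <= d.
have [x r r' _ rr' Pr t t' tt'|x|r r0 Pr] := @uniform_pos R _ P.
- by apply: Pr => i /tt' /lt_le_trans; apply.
- have [r r0 hr] := eval_uniform M (minterm_measure R x) d0; exists r => // t t' tt'.
  by apply: hr => i /free_var_minterm_measure; exact: tt'.
(* [r] keeps the minterm measures within [d]; replacing [s] and [s'] by grid sets costs [e / 4]
   each, which completes the [e / 2] of the matching. *)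
pose r' := Num.min r (e / 4).
have r'0 : 0 < r' by rewrite lt_min r0 divr_gt0.
have approx (t : nat -> M) : exists n0, forall n, (n0 <= n)%N ->
    exists S : nat -> {set 'I_n.+1}, forall i, (i < k)%N ->
      mdist (t i) (grid_class R (S i)) < r'.
  have /choice[n0 hn0] : forall i, exists n0, forall n, (n0 <= n)%N ->
      exists S : {set 'I_n.+1}, mdist (t i) (grid_class R S) < r'.
    by move=> i; exact: grid_approximable_malg.
  exists (\max_(i < k) n0 i)%N => n n0n.
  have /choice[S hS] : forall i, exists S : {set 'I_n.+1}, (i < k)%N ->
      mdist (t i) (grid_class R S) < r'.
    move=> i; have [ik|ki] := ltnP i k; last by exists finset.set0.
    have [S hS] := hn0 i n (leq_trans (leq_bigmax (Ordinal ik)) n0n).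
    by exists S.
  by exists S.
have [n1 h1] := approx s; have [n2 h2] := approx s'.
(* Both tuples are approximated on the same grid. *)
pose n := maxn n1 n2.
have [S hS] := h1 n (leq_maxl _ _); have [S' hS'] := h2 n (leq_maxr _ _).
have close (t : nat -> M) (Q : nat -> {set 'I_n.+1}) x :
    (forall i, (i < k)%N -> mdist (t i) (grid_class R (Q i)) < r') ->
    `|eval M t (minterm_measure R x) - #|[set j | color Q k j == x]%SET|%:R / n.+1%:R| <= d.
  move=> tQ; rewrite -(@eval_minterm_measure R n Q (fun i => grid_class R (Q i)))//.
  by apply: Pr => i /tQ; rewrite lt_min => /andP[].
(* Two approximation errors [d] add to the [d] of the hypothesis on the minterm measures. *)
have [x|p hp] := @grid_matching n k S S' (3 * d).
  have /ltW := ss' (enum_rank x); rewrite enum_rankK.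
  have := close s S x hS; have := close s' S' x hS'.
  move: (_%:R / _) (_%:R / _) (eval _ _ _) (eval _ _ _) (d) => a b u v c.
  rewrite !ler_norml => /andP[? ?] /andP[? ?] /andP[? ?].
  by apply/andP; split; lra.
have ap := exchange_automorphismP R p.
exists (exchange_automorphism p) => // i ik.
have [_ iso _ _] := ap.
have t1 := metric_triangle (exchange_automorphism p (s i))
  (exchange_automorphism p (grid_class R (S i))) (s' i).
have t2 := metric_triangle (exchange_automorphism p (grid_class R (S i)))
  (grid_class R (S' i)) (s' i).
rewrite iso in t1; rewrite (metric_sym (grid_class R (S' i))) in t2.
have := hS i ik; have := hS' i ik; rewrite !lt_min => /andP[_ a1] /andP[_ a2].
have a3 := hp i ik.
have a4 : #|{: k.-tuple bool}|%:R * (3 * d) <= e / 2.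
  rewrite /d mulrA mulrA ler_pdivrMr ?mulr_gt0//.
  rewrite (_ : e / 2 * (6 * K) = K * 3 * e); last by field.
  by rewrite ler_pM2r// ler_pM2r// lerDl.
by move: t1 t2 a1 a2 a3 a4; lra.
Qed.

End malg_homogeneity.

Theorem mainTheorem3 (R : realType) :
  let M := MAlg (@lebesgue01 R) in
  let T := Th M in
  eliminates_quantifiers T /\
  forall n : option nat,
    exists F : orbit_closure_space M n -> type_space T n,
      (forall a : power M n, set_val (F (orbit_closure a)) = tp (T := T) a) /\
      bijective F.
Proof.
move=> M T; split.
  exact/finitely_homogeneous_eliminates_quantifiers/malg_finitely_homogeneous.
by move=> n; exact/finitely_homogeneous_types/malg_finitely_homogeneous.
Qed.
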